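(* Let $n\geq 1$, let $U\subseteq\mathcal{M}_n$ be a domain (nonempty connected open set) containing the null matrix, and let $F:U\rightarrow\mathcal{M}_n$ be a function of class $\mathcal{C}^1$ (in the real sense) with $F(0)=0$ such that $$\sigma(F(x)-F(y))\cap\sigma(x-y)\neq\varnothing\qquad (x,y\in U).$$ Then there exists an invertible $u\in\mathcal{M}_n$ such that either $F(x)=uxu^{-1}$ for all $x\in U$, or $F(x)=ux^{t}u^{-1}$ for all $x\in U$.
   Context: $\mathcal{M}_n$ denotes the space of all complex $n\times n$ matrices (identified with $\mathbb{R}^{2n^2}$ for real differentiability). For $x\in\mathcal{M}_n$, $\sigma(x)$ denotes the spectrum (set of eigenvalues) of $x$, and $x^t$ denotes its transpose. *)

(* Defs.v *)
(* complex numbers as R*R, n x n complex matrices as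
   functions nat -> nat -> C, of which only the entries with indices < n
   matter (all notions below only look at those entries). *)
From Stdlib Require Import Reals.
Open Scope R_scope.

Definition C := (R * R)%type.
Definition C0 : C := (0, 0).
Definition C1 : C := (1, 0).
Definition Cplus (a b : C) : C := (fst a + fst b, snd a + snd b).
Definition Copp (a : C) : C := (- fst a, - snd a).
Definition Cmult (a b : C) : C :=
  (fst a * fst b - snd a * snd b, fst a * snd b + snd a * fst b).
Definition Cnorm (a : C) : R := sqrt (fst a * fst a + snd a * snd a).

Fixpoint Csum (n : nat) (f : nat -> C) : C :=
  match n with O => C0 | S m => Cplus (Csum m f) (f m) end.
Fixpoint Rsum (n : nat) (f : nat -> R) : R :=
  match n with O => 0 | S m => Rsum m f + f m end.

Definition Mat := nat -> nat -> C.
Definition mzero : Mat := fun _ _ => C0.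
Definition mid : Mat := fun i j => if Nat.eqb i j then C1 else C0.
Definition madd (A B : Mat) : Mat := fun i j => Cplus (A i j) (B i j).
Definition msub (A B : Mat) : Mat := fun i j => Cplus (A i j) (Copp (B i j)).
Definition mscal (r : R) (A : Mat) : Mat := fun i j => Cmult (r, 0) (A i j).
Definition mmul (n : nat) (A B : Mat) : Mat :=
  fun i j => Csum n (fun k => Cmult (A i k) (B k j)).
Definition mtr (A : Mat) : Mat := fun i j => A j i.

Definition meq (n : nat) (A B : Mat) : Prop :=
  forall i j, (i < n)%nat -> (j < n)%nat -> A i j = B i j.

Definition mnorm (n : nat) (A : Mat) : R :=
  sqrt (Rsum n (fun i => Rsum n (fun j =>
     fst (A i j) * fst (A i j) + snd (A i j) * snd (A i j)))).

Definition in_spec (n : nat) (x : Mat) (lam : C) : Prop :=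
  exists v : nat -> C,
    (exists i, (i < n)%nat /\ v i <> C0) /\
    forall i, (i < n)%nat -> Csum n (fun k => Cmult (x i k) (v k)) = Cmult lam (v i).

Definition is_open (n : nat) (U : Mat -> Prop) : Prop :=
  forall x, U x -> exists eps, 0 < eps /\
    forall y, mnorm n (msub y x) < eps -> U y.

Definition is_connected (n : nat) (U : Mat -> Prop) : Prop :=
  forall V W : Mat -> Prop, is_open n V -> is_open n W ->
    (forall x, U x -> V x \/ W x) ->
    (exists x, U x /\ V x) -> (exists x, U x /\ W x) ->
    exists x, U x /\ V x /\ W x.

Definition is_domain (n : nat) (U : Mat -> Prop) : Prop :=
  (exists x, U x) /\ is_open n U /\ is_connected n U.

Definition is_Rlinear (n : nat) (L : Mat -> Mat) : Prop :=
  (forall h k, meq n (L (madd h k)) (madd (L h) (L k))) /\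
  (forall (r : R) h, meq n (L (mscal r h)) (mscal r (L h))).

Definition is_C1_on (n : nat) (U : Mat -> Prop) (F : Mat -> Mat) : Prop :=
  exists DF : Mat -> Mat -> Mat,
    (forall x, U x -> is_Rlinear n (DF x)) /\
    (forall x, U x -> forall eps, 0 < eps -> exists delta, 0 < delta /\
       forall h, mnorm n h < delta -> U (madd x h) ->
         mnorm n (msub (msub (F (madd x h)) (F x)) (DF x h)) <= eps * mnorm n h) /\
    (forall x, U x -> forall eps, 0 < eps -> exists delta, 0 < delta /\
       forall y, U y -> mnorm n (msub y x) < delta ->
         forall h, mnorm n (msub (DF y h) (DF x h)) <= eps * mnorm n h).

(* Main.v *)
Require Import Defs.
From Stdlib Require Import Reals Lra Classical FunctionalExtensionality.
From Coquelicot Require Import Coquelicot.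

(** Differentiating the eigenvalue condition at a point, every derivative A_x = DF(x) is a
    real-linear map of M_n sharing an eigenvalue with each of its arguments.

    Such a map L preserves all eigenvalues. The product over i of
    det (L (g D adj g) - det g d_i) vanishes identically in (g, D), D = diag(d), and its factors
    are polynomial along real lines, so one factor vanishes identically; conjugating by
    permutation matrices, all of them do. Hence tr ((L h)^k) = tr (h^k) for diagonalisable h and,
    perturbing a triangular form, for all h. The case k = 2 makes L a bijective complex-linear
    isometry of the form tr (h k), the case k = 3 makes it a Jordan map, and Herstein's identity
    makes a Jordan map a homomorphism or an antihomomorphism, that is inner up to transposition.

    So F is holomorphic with isometric derivatives. Cauchy estimates bound the first and second
    differences of A, and the Christoffel argument applies: tr ((A_{x+k} h - A_x h) A_x l) is
    symmetric in (k, h) and antisymmetric in (h, l) up to fourth order, hence negligible. Thus A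
    is locally constant, F is locally affine, and F = A_0 on U by connectedness. *)

(** * The Cauchy estimate *)

(** The eigenvalue condition yields, for each pair of points, one common eigenvalue that varies with
    the pair in an uncontrolled way; the absence of zero divisors among polynomial functions turns
    it into a uniform choice. A derivative of F is at first only real-linear, so polynomials in real
    coordinates are needed, and restriction to real lines reduces them to one variable.

    The other obstacle is regularity: F is only C^1, and the invariant form tr (h k) is complex
    bilinear and defines no norm, so neither second derivatives nor metric arguments are at hand.
    Complex linearity of the derivatives repairs this: Cauchy estimates control second differences,
    and finite differences replace Christoffel symbols. The trace in the Christoffel argument is a
    priori of third order, so a fourth-order bound makes the derivative of A vanish.

    The algebra and the rigidity argument are carried out over a real closed field; real analysis
    enters only through [mean_value_property] and [cauchy_property]. *)

Section CauchyEstimates.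
Local Open Scope R_scope.

Lemma continuity_2d_pt_comp (g f h : R -> R -> R) (x y : R) :
  continuity_2d_pt g (f x y) (h x y) -> continuity_2d_pt f x y -> continuity_2d_pt h x y ->
  continuity_2d_pt (fun a b => g (f a b) (h a b)) x y.
Proof.
intros Hg Hf Hh eps.
destruct (Hg eps) as [d Hd].
destruct (Hf d) as [d1 H1]; destruct (Hh d) as [d2 H2].
assert (Hp : 0 < Rmin d1 d2) by (apply Rmin_pos; [apply d1 | apply d2]).
exists (mkposreal _ Hp); simpl; intros u v Hu Hv.
apply Hd; [apply H1 | apply H2]; eapply Rlt_le_trans; try eassumption;
  first [apply Rmin_l | apply Rmin_r].
Qed.

Lemma continuity_2d_pt_fix_l (g : R -> R -> R) (x y : R) :
  continuity_2d_pt g x y -> continuous (fun b => g x b) y.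
Proof.
intros Hg; apply filterlim_locally; intros eps.
destruct (Hg eps) as [d Hd]; exists d; intros z Hz; apply Hd; [|exact Hz].
rewrite Rminus_diag; rewrite Rabs_R0; apply d.
Qed.

Section CauchyEstimate.

(* f = u + i v is holomorphic on the disc of radius rho, with derivative g1 + i g2. *)
Variables (u v g1 g2 : R -> R -> R) (rho : R).
Hypothesis u_diff : forall a b, a * a + b * b < rho * rho ->
  differentiable_pt_lim u a b (g1 a b) (- g2 a b).
Hypothesis v_diff : forall a b, a * a + b * b < rho * rho ->
  differentiable_pt_lim v a b (g2 a b) (g1 a b).
Hypothesis g1_cont : forall a b, a * a + b * b < rho * rho -> continuity_2d_pt g1 a b.

(** With z = r e^{it}, [P] is the real part of e^{-it} f(z), [W] is minus its imaginary part, and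
    [G] is the real part of f'(z). *)
Let P r t := cos t * u (r * cos t) (r * sin t) + sin t * v (r * cos t) (r * sin t).
Let G r t := g1 (r * cos t) (r * sin t).
Let W r t := sin t * u (r * cos t) (r * sin t) - cos t * v (r * cos t) (r * sin t).

Lemma polar_in_disc r t : Rabs r < rho ->
  r * cos t * (r * cos t) + r * sin t * (r * sin t) < rho * rho.
Proof.
intros Hr.
replace (r * cos t * (r * cos t) + r * sin t * (r * sin t)) with (Rabs r * Rabs r).
- pose proof (Rabs_pos r); nra.
- rewrite <- Rabs_mult, Rabs_pos_eq by nra.
  pose proof (sin2_cos2 t) as H; unfold Rsqr in H.
  transitivity (r * r * (sin t * sin t + cos t * cos t)); [rewrite H |]; ring.
Qed.

Lemma P_derive_radius r t : Rabs r < rho -> is_derive (fun z => P z t) r (G r t).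
Proof.
intros Hr; pose proof (polar_in_disc r t Hr) as Hd.
apply is_derive_Reals.
replace (G r t) with
  (cos t * (g1 (r * cos t) (r * sin t) * cos t + - g2 (r * cos t) (r * sin t) * sin t)
   + sin t * (g2 (r * cos t) (r * sin t) * cos t + g1 (r * cos t) (r * sin t) * sin t)).
2:{ pose proof (sin2_cos2 t) as H; unfold Rsqr in H; unfold G.
  transitivity (g1 (r * cos t) (r * sin t) * (sin t * sin t + cos t * cos t));
    [|rewrite H]; ring. }
assert (Hc : derivable_pt_lim (fun z => z * cos t) r (cos t))
  by (apply is_derive_Reals; auto_derive; [trivial | ring]).
assert (Hs : derivable_pt_lim (fun z => z * sin t) r (sin t))
  by (apply is_derive_Reals; auto_derive; [trivial | ring]).
apply derivable_pt_lim_plus; apply derivable_pt_lim_scal.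
- exact (derivable_pt_lim_comp_2d u _ _ r _ _ _ _ (u_diff _ _ Hd) Hc Hs).
- exact (derivable_pt_lim_comp_2d v _ _ r _ _ _ _ (v_diff _ _ Hd) Hc Hs).
Qed.

Lemma W_derive_angle r t : Rabs r < rho -> is_derive (fun z => W r z) t (P r t - r * G r t).
Proof.
intros Hr; pose proof (polar_in_disc r t Hr) as Hd.
apply is_derive_Reals.
assert (Hc : derivable_pt_lim (fun z => r * cos z) t (- (r * sin t)))
  by (apply is_derive_Reals; auto_derive; [trivial | ring]).
assert (Hs : derivable_pt_lim (fun z => r * sin z) t (r * cos t))
  by (apply is_derive_Reals; auto_derive; [trivial | ring]).
pose proof (derivable_pt_lim_comp_2d u _ _ t _ _ _ _ (u_diff _ _ Hd) Hc Hs) as Hu.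
pose proof (derivable_pt_lim_comp_2d v _ _ t _ _ _ _ (v_diff _ _ Hd) Hc Hs) as Hv.
pose proof (derivable_pt_lim_minus _ _ _ _ _
  (derivable_pt_lim_mult sin _ t _ _ (derivable_pt_lim_sin t) Hu)
  (derivable_pt_lim_mult cos _ t _ _ (derivable_pt_lim_cos t) Hv)) as HW.
match type of HW with derivable_pt_lim _ _ ?l => replace (P r t - r * G r t) with l end.
- exact HW.
- pose proof (sin2_cos2 t) as H; unfold Rsqr in H; unfold P, G.
  replace (r * g1 (r * cos t) (r * sin t)) with
    (r * g1 (r * cos t) (r * sin t) * (sin t * sin t + cos t * cos t)) by (rewrite H; ring).
  ring.
Qed.

Lemma G_cont r t : Rabs r < rho -> continuity_2d_pt G r t.
Proof.
intros Hr; apply (continuity_2d_pt_comp g1 (fun a b => a * cos b) (fun a b => a * sin b)).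
- apply g1_cont, polar_in_disc, Hr.
- apply continuity_2d_pt_mult; [apply continuity_2d_pt_id1|].
  apply (continuity_1d_2d_pt_comp cos (fun _ b => b)); [apply continuity_cos | apply continuity_2d_pt_id2].
- apply continuity_2d_pt_mult; [apply continuity_2d_pt_id1|].
  apply (continuity_1d_2d_pt_comp sin (fun _ b => b)); [apply continuity_sin | apply continuity_2d_pt_id2].
Qed.

Lemma P_cont r t : Rabs r < rho -> continuous (fun z => P r z) t.
Proof.
intros Hr; pose proof (polar_in_disc r t Hr) as Hd.
assert (Hc : continuity_2d_pt (fun a b => a * cos b) r t).
{ apply continuity_2d_pt_mult; [apply continuity_2d_pt_id1|].
  apply (continuity_1d_2d_pt_comp cos (fun _ b => b)); [apply continuity_cos | apply continuity_2d_pt_id2]. }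
assert (Hs : continuity_2d_pt (fun a b => a * sin b) r t).
{ apply continuity_2d_pt_mult; [apply continuity_2d_pt_id1|].
  apply (continuity_1d_2d_pt_comp sin (fun _ b => b)); [apply continuity_sin | apply continuity_2d_pt_id2]. }
apply (continuity_2d_pt_fix_l P).
apply continuity_2d_pt_plus; apply continuity_2d_pt_mult.
- apply (continuity_1d_2d_pt_comp cos (fun _ b => b)); [apply continuity_cos | apply continuity_2d_pt_id2].
- apply (continuity_2d_pt_comp u (fun a b => a * cos b) (fun a b => a * sin b)); trivial.
  apply differentiable_continuity_pt; exists (g1 (r * cos t) (r * sin t)), (- g2 (r * cos t) (r * sin t)).
  now apply u_diff.
- apply (continuity_1d_2d_pt_comp sin (fun _ b => b)); [apply continuity_sin | apply continuity_2d_pt_id2].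
- apply (continuity_2d_pt_comp v (fun a b => a * cos b) (fun a b => a * sin b)); trivial.
  apply differentiable_continuity_pt; exists (g2 (r * cos t) (r * sin t)), (g1 (r * cos t) (r * sin t)).
  now apply v_diff.
Qed.

(** Up to the factor 2 pi r, [c r] is the real part of the first Taylor coefficient of f at 0, as
    the lemmas below show. *)
Let c r : R := RInt (P r) 0 (2 * PI).
Let d r : R := RInt (G r) 0 (2 * PI).

Lemma near_in_disc r : Rabs r < rho -> exists e : posreal,
  forall s, Rabs (s - r) < e -> Rabs s < rho.
Proof.
intros Hr; assert (He : 0 < rho - Rabs r) by lra.
exists (mkposreal _ He); simpl; intros s Hs.
pose proof (Rabs_triang (s - r) r) as H; replace (s - r + r) with s in H by ring; lra.
Qed.

Lemma c_derive r : Rabs r < rho -> is_derive c r (d r).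
Proof.
intros Hr; destruct (near_in_disc r Hr) as [e He].
replace (d r) with (RInt (fun t => Derive (fun z => P z t) r) 0 (2 * PI)).
2:{ apply RInt_ext; intros t _; apply is_derive_unique, P_derive_radius, Hr. }
apply (is_derive_RInt_param P 0 (2 * PI) r).
- exists e; intros s Hs t _; exists (G s t); apply P_derive_radius, He, Hs.
- intros t _; apply (continuity_2d_pt_ext_loc G); [|apply G_cont, Hr].
  exists e; intros a b Ha _; symmetry; apply is_derive_unique, P_derive_radius, He, Ha.
- exists e; intros s Hs; apply (@ex_RInt_continuous R_CompleteNormedModule); intros t _; apply P_cont, He, Hs.
Qed.

(** [W] is 2 pi-periodic in the angle, so its derivative P - r G integrates to zero over the
    circle. *)
Lemma c_euler r : Rabs r < rho -> c r = r * d r.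
Proof.
intros Hr.
assert (HG : ex_RInt (G r) 0 (2 * PI)).
{ apply (@ex_RInt_continuous R_CompleteNormedModule); intros t _; apply (continuity_2d_pt_fix_l G), G_cont, Hr. }
assert (HP : ex_RInt (P r) 0 (2 * PI)).
{ apply (@ex_RInt_continuous R_CompleteNormedModule); intros t _; apply P_cont, Hr. }
assert (HW : is_RInt (fun t => P r t - r * G r t) 0 (2 * PI) (minus (W r (2 * PI)) (W r 0))).
{ apply (is_RInt_derive (W r)); intros t _; [apply W_derive_angle, Hr|].
  apply (continuous_minus (fun t => P r t) (fun t => r * G r t)); [apply P_cont, Hr|].
  apply (continuous_scal_r r (fun t => G r t)), (continuity_2d_pt_fix_l G), G_cont, Hr. }
assert (HW' : is_RInt (fun t => P r t - r * G r t) 0 (2 * PI) (minus (c r) (scal r (d r)))).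
{ apply (is_RInt_minus (P r) (fun t => scal r (G r t))); [apply (RInt_correct (P r)), HP|].
  apply (is_RInt_scal (G r)), (RInt_correct (G r)), HG. }
pose proof (is_RInt_unique _ _ _ _ HW) as H1.
rewrite (is_RInt_unique _ _ _ _ HW') in H1.
unfold W, minus, plus, opp, scal in H1; simpl in H1; unfold mult in H1; simpl in H1.
rewrite sin_2PI, cos_2PI, sin_0, cos_0, Rmult_0_r, Rmult_1_r in H1; lra.
Qed.

Lemma d_zero : 0 < rho -> d 0 = 2 * PI * g1 0 0.
Proof.
intros Hrho; unfold d, G; rewrite (RInt_ext _ (fun _ => g1 0 0)).
- rewrite RInt_const; transitivity ((2 * PI - 0) * g1 0 0); [reflexivity | ring].
- intros t _; rewrite !Rmult_0_l; reflexivity.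
Qed.

(** Since c' = d and c = r d, the quotient c / r has derivative zero at positive radii; its limit at
    0 is c'(0), which is d 0. *)
Lemma cauchy_first_coefficient r : 0 < r < rho -> c r = 2 * PI * r * g1 0 0.
Proof.
intros [Hr0 Hr].
assert (H0 : c 0 = 0) by (rewrite c_euler; [ring | rewrite Rabs_R0; lra]).
assert (Hconst : forall s, 0 < s < r -> c s / s = c r / r).
{ intros s Hs.
  assert (Hd : forall z, s <= z <= r -> is_derive (fun z => c z / z) z 0).
  { intros z Hz; assert (Hz' : Rabs z < rho) by (rewrite Rabs_pos_eq; lra).
    replace 0 with ((d z * z - c z * 1) / z ^ 2).
    - apply (is_derive_div c (fun z => z)); [apply c_derive, Hz' | apply (is_derive_id z) | lra].
    - rewrite (c_euler z Hz'); field; lra. }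
  destruct (MVT_gen (fun z => c z / z) s r (fun _ => 0)) as [z [_ Hz]].
  - intros z Hz; apply Hd; rewrite Rmin_left, Rmax_right in Hz; lra.
  - intros z Hz; rewrite Rmin_left, Rmax_right in Hz by lra.
    apply continuity_pt_filterlim, (ex_derive_continuous (fun z => c z / z)).
    exists 0; apply Hd; lra.
  - lra. }
assert (HD : derivable_pt_lim c 0 (d 0)).
{ apply is_derive_Reals, c_derive; rewrite Rabs_R0; lra. }
rewrite d_zero in HD by lra.
assert (Hlim : c r / r = 2 * PI * g1 0 0).
{ destruct (Req_dec (c r / r) (2 * PI * g1 0 0)) as [|Hne]; [assumption|exfalso].
  assert (He : 0 < Rabs (c r / r - 2 * PI * g1 0 0)) by (apply Rabs_pos_lt; lra).
  destruct (HD _ He) as [e Hd].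
  pose (s := Rmin e r / 2).
  assert (Hm : 0 < Rmin e r) by (apply Rmin_pos; [apply e | lra]).
  pose proof (Rmin_l e r); pose proof (Rmin_r e r).
  assert (Hs : 0 < s < r) by (unfold s; lra).
  specialize (Hd s); rewrite Rplus_0_l, H0, Rminus_0_r, (Hconst s Hs) in Hd.
  assert (Hse : Rabs s < e) by (rewrite Rabs_pos_eq; unfold s; lra).
  assert (Hs0 : s <> 0) by lra.
  pose proof (Hd Hs0 Hse); lra. }
replace (c r) with (c r / r * r) by (field; lra); rewrite Hlim; ring.
Qed.

Lemma cauchy_estimate r E : 0 < r < rho ->
  (forall a b, a * a + b * b < rho * rho -> Rabs (u a b) <= E /\ Rabs (v a b) <= E) ->
  r * Rabs (g1 0 0) <= 2 * E.
Proof.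
intros Hr HE.
assert (Hr' : Rabs r < rho) by (rewrite Rabs_pos_eq; lra).
assert (HP : ex_RInt (P r) 0 (2 * PI)).
{ apply (@ex_RInt_continuous R_CompleteNormedModule); intros t _; apply P_cont, Hr'. }
pose proof PI_RGT_0 as Hpi.
assert (Hb : Rabs (c r) <= (2 * PI - 0) * (2 * E)).
{ apply (abs_RInt_le_const (P r)); [lra | exact HP|].
  intros t _; destruct (HE _ _ (polar_in_disc r t Hr')) as [Hu Hv].
  unfold P; eapply Rle_trans; [apply Rabs_triang|]; rewrite !Rabs_mult.
  assert (Rabs (cos t) <= 1) by (apply Rabs_le, COS_bound).
  assert (Rabs (sin t) <= 1) by (apply Rabs_le, SIN_bound).
  pose proof (Rabs_pos (cos t)); pose proof (Rabs_pos (sin t)).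
  pose proof (Rabs_pos (u (r * cos t) (r * sin t))).
  pose proof (Rabs_pos (v (r * cos t) (r * sin t))); nra. }
rewrite (cauchy_first_coefficient r Hr), !Rabs_mult in Hb.
rewrite (Rabs_pos_eq 2), (Rabs_pos_eq PI), (Rabs_pos_eq r) in Hb by lra.
apply (Rmult_le_reg_l (2 * PI)); [lra|].
replace (2 * PI * (r * Rabs (g1 0 0))) with (2 * PI * r * Rabs (g1 0 0)) by ring; lra.
Qed.

End CauchyEstimate.

End CauchyEstimates.

From HB Require Import structures.
From mathcomp Require Import all_boot all_order all_algebra all_fingroup.
From mathcomp Require Import spectral complex Rstruct ring lra.
Set Implicit Arguments.
Unset Strict Implicit.
Unset Printing Implicit Defensive.
Import Order.TTheory GRing.Theory Num.Theory.
Delimit Scope R_scope with coqR.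
Delimit Scope ring_scope with R.
Local Open Scope ring_scope.
Local Open Scope complex_scope.
Local Notation Re := complex.Re.
Local Notation Im := complex.Im.

(** * Functions polynomial along real lines *)

Section PolynomialAlongLines.
Variable R : rcfType.
Local Notation C := R[i].

(** Multiplication by the polynomial [S] with root list s absorbs the exceptional parameters: P * S
    vanishes at every natural number, hence at more points than its degree allows. *)
Lemma poly_eq0_real (P : {poly C}) (s : seq R) :
  (forall t : R, t \notin s -> P.[t%:C] = 0) -> P = 0.
Proof.
move=> P0; pose S := \prod_(a <- s) ('X - (a%:C)%:P).
have S0 : S != 0 by rewrite monic_neq0 // monic_prod_XsubC.
have [/eqP|PS0] := eqVneq (P * S) 0.
  by rewrite mulf_eq0 (negPf S0) orbF => /eqP.
have := @max_poly_roots _ (P * S) [seq (i%:R : R)%:C | i <- iota 0 (size (P * S))] PS0.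
rewrite size_map size_iota ltnn => roots; suff: false by []; apply: roots.
  apply/allP=> _ /mapP[i _ ->]; rewrite /root hornerM mulf_eq0.
  have [si|/P0 ->] := boolP ((i%:R : R) \in s); last by rewrite eqxx.
  by rewrite /S (big_rem _ si) /= hornerM hornerXsubC subrr mul0r eqxx orbT.
rewrite map_inj_uniq ?iota_uniq // => i j [] /eqP.
by rewrite eqr_nat => /eqP.
Qed.

(** A substitute for multivariate polynomials. The parameter is real so that conjugation, and with
    it real and imaginary parts, preserve the class. *)
Definition poly_on_lines (V : lmodType C) (f : V -> C) :=
  forall p q : V, exists P : {poly C}, forall t : R, f (p + t%:C *: q) = P.[t%:C].

Section Closure.
Variable V : lmodType C.
Implicit Types f g : V -> C.

Lemma poly_on_lines_ext f g : f =1 g -> poly_on_lines f -> poly_on_lines g.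
Proof. by move=> fg hf p q; have [P hP] := hf p q; exists P => t; rewrite -fg. Qed.

Lemma poly_on_lines_const c : poly_on_lines (fun _ : V => c).
Proof. by move=> p q; exists c%:P => t; rewrite hornerC. Qed.

Lemma poly_on_linesD f g :
  poly_on_lines f -> poly_on_lines g -> poly_on_lines (fun x => f x + g x).
Proof.
move=> hf hg p q; have [P hP] := hf p q; have [Q hQ] := hg p q.
by exists (P + Q) => t; rewrite hornerD hP hQ.
Qed.

Lemma poly_on_linesM f g :
  poly_on_lines f -> poly_on_lines g -> poly_on_lines (fun x => f x * g x).
Proof.
move=> hf hg p q; have [P hP] := hf p q; have [Q hQ] := hg p q.
by exists (P * Q) => t; rewrite hornerM hP hQ.
Qed.

Lemma poly_on_linesN f : poly_on_lines f -> poly_on_lines (fun x => - f x).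
Proof. by move=> hf p q; have [P hP] := hf p q; exists (- P) => t; rewrite hornerN hP. Qed.

Lemma poly_on_linesB f g :
  poly_on_lines f -> poly_on_lines g -> poly_on_lines (fun x => f x - g x).
Proof. by move=> hf hg; apply: poly_on_linesD => //; apply: poly_on_linesN. Qed.

Lemma poly_on_lines_sum (I : Type) (s : seq I) (Q : pred I) (f : I -> V -> C) :
  (forall i, poly_on_lines (f i)) -> poly_on_lines (fun x => \sum_(i <- s | Q i) f i x).
Proof.
move=> hf; elim: s => [|i s IH].
  by apply: poly_on_lines_ext (poly_on_lines_const 0) => x; rewrite big_nil.
case Qi: (Q i).
  by apply: poly_on_lines_ext (poly_on_linesD (hf i) IH) => x; rewrite big_cons Qi.
by apply: poly_on_lines_ext IH => x; rewrite big_cons Qi.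
Qed.

Lemma poly_on_lines_prod (I : Type) (s : seq I) (Q : pred I) (f : I -> V -> C) :
  (forall i, poly_on_lines (f i)) -> poly_on_lines (fun x => \prod_(i <- s | Q i) f i x).
Proof.
move=> hf; elim: s => [|i s IH].
  by apply: poly_on_lines_ext (poly_on_lines_const 1) => x; rewrite big_nil.
case Qi: (Q i).
  by apply: poly_on_lines_ext (poly_on_linesM (hf i) IH) => x; rewrite big_cons Qi.
by apply: poly_on_lines_ext IH => x; rewrite big_cons Qi.
Qed.

Lemma poly_on_lines_conj f : poly_on_lines f -> poly_on_lines (fun x => (f x)^*).
Proof.
move=> hf p q; have [P hP] := hf p q; exists (map_poly (@conjc R) P) => t.
by rewrite hP -[in RHS](conjc_real t) horner_map.
Qed.

Lemma poly_on_lines_Re f : poly_on_lines f -> poly_on_lines (fun x => (complex.Re (f x))%:C).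
Proof.
move=> hf; have h := poly_on_linesM (poly_on_linesD hf (poly_on_lines_conj hf))
  (poly_on_lines_const (2%:R^-1)).
by apply: poly_on_lines_ext h => x; rewrite ReJ_add.
Qed.

Lemma poly_on_lines_Im f : poly_on_lines f -> poly_on_lines (fun x => (complex.Im (f x))%:C).
Proof.
move=> hf; have h := poly_on_linesM (poly_on_linesB (poly_on_lines_conj hf) hf)
  (poly_on_lines_const (2%:R^-1 * 'i%C)).
by apply: poly_on_lines_ext h => x; rewrite ImJ_sub mulrA.
Qed.

Lemma poly_on_lines_det n (A : V -> 'M[C]_n) :
  (forall i j, poly_on_lines (fun x => A x i j)) -> poly_on_lines (fun x => \det (A x)).
Proof.
move=> hA; apply: poly_on_lines_sum => s; apply: poly_on_linesM.
  exact: poly_on_lines_const.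
by apply: poly_on_lines_prod => i; apply: hA.
Qed.

Lemma poly_on_lines_mul m n p (A : V -> 'M[C]_(m, n)) (B : V -> 'M[C]_(n, p)) :
  (forall i j, poly_on_lines (fun x => A x i j)) ->
  (forall i j, poly_on_lines (fun x => B x i j)) ->
  forall i j, poly_on_lines (fun x => (A x *m B x) i j).
Proof.
move=> hA hB i j.
apply: (@poly_on_lines_ext (fun x => \sum_k A x i k * B x k j)).
  by move=> x; rewrite mxE.
by apply: poly_on_lines_sum => k; apply: poly_on_linesM.
Qed.

Lemma poly_on_lines_adj n (A : V -> 'M[C]_n) :
  (forall i j, poly_on_lines (fun x => A x i j)) ->
  forall i j, poly_on_lines (fun x => (\adj (A x)) i j).
Proof.
move=> hA i j.
apply: (@poly_on_lines_ext (fun x => cofactor (A x) j i)); first by move=> x; rewrite mxE.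
apply: poly_on_linesM; first exact: poly_on_lines_const.
apply: poly_on_lines_det => k l.
by apply: poly_on_lines_ext (hA (lift j k) (lift i l)) => x; rewrite !mxE.
Qed.

Lemma poly_on_lines_linear f :
  (forall x y, f (x + y) = f x + f y) -> (forall (r : R) x, f (r%:C *: x) = r%:C * f x) ->
  poly_on_lines f.
Proof.
move=> fD fZ p q; exists ((f p)%:P + 'X * (f q)%:P) => t.
by rewrite fD fZ !hornerE.
Qed.

(** Join a point p with f p nonzero to a point q with g q nonzero: along this line the product of
    two one-variable polynomials is zero, so one of them is. *)
Lemma poly_on_lines_zero_divisor f g : poly_on_lines f -> poly_on_lines g ->
  (forall x, f x * g x = 0) -> (forall x, f x = 0) \/ (forall x, g x = 0).
Proof.
move=> hf hg fg0; apply: NNPP => /not_or_and[/not_all_ex_not[p fp] /not_all_ex_not[q gq]].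
have [P hP] := hf p (q - p); have [Q hQ] := hg p (q - p).
have /eqP : P * Q = 0.
  by apply: (@poly_eq0_real _ [::]) => t _; rewrite hornerM -hP -hQ.
rewrite mulf_eq0 => /orP[]/eqP h0.
  by apply: fp; have := hP 0; rewrite scale0r addr0 h0 horner0.
by apply: gq; have := hQ 1; rewrite scale1r addrC subrK h0 horner0.
Qed.

Lemma poly_on_lines_prod_eq0 (I : eqType) (s : seq I) (f : I -> V -> C) :
  (forall i, poly_on_lines (f i)) -> (forall x, \prod_(i <- s) f i x = 0) ->
  exists i, forall x, f i x = 0.
Proof.
move=> hf; elim: s => [|i s IH] h.
  by have := h 0; rewrite big_nil => /eqP; rewrite oner_eq0.
have hs : poly_on_lines (fun x => \prod_(i <- s) f i x) by apply: poly_on_lines_prod.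
have fs0 x : f i x * \prod_(i <- s) f i x = 0 by have := h x; rewrite big_cons.
by have [h0|/IH//] := poly_on_lines_zero_divisor (hf i) hs fs0; exists i.
Qed.

End Closure.

End PolynomialAlongLines.

(** * Real-linear maps preserving an eigenvalue *)

Section TracePowers.

Lemma char_poly_conj (F : fieldType) n (P A : 'M[F]_n) :
  P \in unitmx -> char_poly (P *m A *m invmx P) = char_poly A.
Proof.
move=> uP; rewrite /char_poly.
have -> : char_poly_mx (P *m A *m invmx P)
  = map_mx polyC P *m char_poly_mx A *m map_mx polyC (invmx P).
  rewrite /char_poly_mx mulmxBr mulmxBl -!map_mxM; congr (_ - _).
  by rewrite scalar_mxC -mulmxA -map_mxM mulmxV // map_mx1 mulmx1.
rewrite !det_mulmx mulrAC -det_mulmx -map_mxM mulmxV // map_mx1 det1.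
by rewrite mul1r.
Qed.

Lemma trig_mulmx (F : comNzRingType) n (S T : 'M[F]_n) :
  is_trig_mx S -> is_trig_mx T ->
  is_trig_mx (S *m T) /\ forall i, (S *m T) i i = S i i * T i i.
Proof.
move=> /is_trig_mxP hS /is_trig_mxP hT; split=> [|i].
  apply/is_trig_mxP => i j ij; rewrite mxE big1 // => k _.
  have [ik|ki] := ltnP i k; first by rewrite hS ?mul0r.
  by rewrite hT ?mulr0 // (leq_ltn_trans ki).
rewrite mxE (bigD1 i) //= big1 ?addr0 // => k kNi.
have [ik|] := ltnP i k; first by rewrite hS ?mul0r.
rewrite leq_eqVlt => /orP[/eqP/val_inj ki|ki]; first by rewrite ki eqxx in kNi.
by rewrite hT ?mulr0.
Qed.

(** In a Schur triangular form the powers have the powers of the diagonal on their diagonal, and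
    unique factorisation matches that diagonal with d up to order. *)
Lemma mxtrace_exp (K : numClosedFieldType) n (A : 'M[K]_n.+1) (d : 'I_n.+1 -> K) k :
  char_poly A = \prod_i ('X - (d i)%:P) -> \tr (A ^+ k) = \sum_i d i ^+ k.
Proof.
have [P /unitarymx_unit uP] := Schur A isT.
rewrite /similar_to conjumx //; set T := P *m A *m invmx P => tT.
have <- : char_poly T = char_poly A by rewrite char_poly_conj.
rewrite char_poly_trig // => eqd.
have {eqd} pd : perm_eq [seq T i i | i <- index_enum 'I_n.+1] [seq d i | i <- index_enum 'I_n.+1].
  by apply: prod_XsubC_eq; rewrite !big_map.
have [_ dT] : is_trig_mx (T ^+ k) /\ forall i, (T ^+ k) i i = T i i ^+ k.
  elim: k => [|k [tk dk]].
    split=> [|i]; first exact: scalar_mx_is_trig.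
    by rewrite !expr0 mxE eqxx.
  rewrite exprS; have [h1 h2] := trig_mulmx tT tk; split=> // i.
  by rewrite h2 dk exprS.
have -> : \tr (A ^+ k) = \tr (T ^+ k).
  have TP : T *m P = P *m A by rewrite mulmxKV.
  have : T ^+ k *m P = P *m A ^+ k.
    elim: k => [|k IH] in dT *; first by rewrite !expr0 mul1mx mulmx1.
    rewrite !exprSr -!mulmxE -mulmxA TP mulmxA mulmxA; congr (_ *m _).
    elim: {dT IH} k => [|k IH]; first by rewrite !expr0 mul1mx mulmx1.
    by rewrite !exprSr -!mulmxE -mulmxA TP mulmxA IH mulmxA.
  move=> /(congr1 (mulmx^~ (invmx P))); rewrite mulmxK // => ->.
  by rewrite mxtrace_mulC mulmxA mulVmx // mul1mx.
rewrite /mxtrace (eq_bigr (fun i => T i i ^+ k)) //.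
by rewrite -(big_map (fun i => T i i) xpredT (fun x => x ^+ k)) (perm_big _ pd) big_map.
Qed.

Lemma root_char_polyE (F : fieldType) n (A : 'M[F]_n) a :
  root (char_poly A) a = (\det (A - a%:M) == 0).
Proof.
rewrite -eigenvalue_root_char /eigenvalue /eigenspace kermx_eq0 row_free_unit.
by rewrite unitmxE unitfE negbK.
Qed.

End TracePowers.

Section RealLinear.
Variables (R : rcfType) (n' : nat).
Local Notation C := R[i].
Local Notation n := n'.+1.
Local Notation M := 'M[C]_n.

Definition real_linear (L : M -> M) :=
  (forall h k, L (h + k) = L h + L k) /\ (forall (r : R) h, L (r%:C *: h) = r%:C *: L h).

Definition common_eigenvalue (A B : M) :=
  exists l, \det (A - l%:M) = 0 /\ \det (B - l%:M) = 0.

Variable L : M -> M.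
Hypothesis linL : real_linear L.

Lemma real_linear0 : L 0 = 0.
Proof. by have := linL.2 0 0; rewrite !scale0r. Qed.

Lemma real_linear_sum (I : Type) (s : seq I) (f : I -> M) :
  L (\sum_(i <- s) f i) = \sum_(i <- s) L (f i).
Proof.
elim: s => [|i s IH]; first by rewrite !big_nil real_linear0.
by rewrite !big_cons linL.1 IH.
Qed.

Lemma real_linearN h : L (- h) = - L h.
Proof. by apply/eqP; rewrite -subr_eq0 opprK -linL.1 addNr real_linear0. Qed.

Lemma real_linearB h k : L (h - k) = L h - L k.
Proof. by rewrite linL.1 real_linearN. Qed.

Lemma real_linearE h : L h = \sum_i \sum_j
  ((complex.Re (h i j))%:C *: L (delta_mx i j)
   + (complex.Im (h i j))%:C *: L ('i%C *: delta_mx i j)).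
Proof.
rewrite [in LHS](matrix_sum_delta h) real_linear_sum; apply: eq_bigr => i _.
rewrite real_linear_sum; apply: eq_bigr => j _.
by rewrite [in LHS](complexE (h i j)) scalerDl linL.1 linL.2 mulrC -scalerA linL.2.
Qed.

Lemma poly_on_lines_real_linear (V : lmodType C) (A : V -> M) :
  (forall i j, poly_on_lines (fun x => A x i j)) ->
  forall i j, poly_on_lines (fun x => L (A x) i j).
Proof.
move=> hA k l.
have hs : poly_on_lines (fun x => \sum_i \sum_j
   ((complex.Re (A x i j))%:C * L (delta_mx i j) k l
   + (complex.Im (A x i j))%:C * L ('i%C *: delta_mx i j) k l)).
  apply: poly_on_lines_sum => i; apply: poly_on_lines_sum => j.
  apply: poly_on_linesD; apply: poly_on_linesM; try exact: poly_on_lines_const.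
    exact: poly_on_lines_Re.
  exact: poly_on_lines_Im.
apply: poly_on_lines_ext hs => x; rewrite [in RHS]real_linearE summxE.
by apply: eq_bigr => i _; rewrite summxE; apply: eq_bigr => j _; rewrite !mxE.
Qed.

Hypothesis specL : forall h, common_eigenvalue (L h) h.

Lemma det_diag_shift (d : 'rV[C]_n) (l : C) :
  \det (diag_mx d - l%:M) = \prod_i (d 0 i - l).
Proof.
have -> : diag_mx d - l%:M = diag_mx (d - const_mx l).
  by apply/matrixP => i j; rewrite !mxE -mulrnBl.
by rewrite det_diag; apply: eq_bigr => i _; rewrite !mxE.
Qed.

Lemma det_conj_shift (g A : M) (l : C) : g \in unitmx ->
  \det (g *m A *m invmx g - l%:M) = \det (A - l%:M).
Proof.
move=> ug; have -> : g *m A *m invmx g - l%:M = g *m (A - l%:M) *m invmx g.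
  by rewrite mulmxBr mulmxBl scalar_mxC mulmxK.
by rewrite !det_mulmx mulrAC -det_mulmx mulmxV // det1 mul1r.
Qed.

Lemma poly_on_lines_entry m k i j : poly_on_lines (fun A : 'M[C]_(m, k) => A i j).
Proof. by apply: poly_on_lines_linear => [x y|r x]; rewrite mxE. Qed.

(** The index i0 is chosen before g and d. This uniformity is what allows the eigenvalues to be
    permuted in [diag_eigenvalues]. *)
Lemma exists_common_index : exists i0 : 'I_n, forall (g : M) (d : 'rV[C]_n),
  g \in unitmx -> \det (L (g *m diag_mx d *m invmx g) - (d 0 i0)%:M) = 0.
Proof.
pose V := ('M[C]_n * 'rV[C]_n)%type.
(* The adjugate replaces the inverse to stay polynomial; for invertible g the matrix is then
   conjugate to det g times the diagonal one, hence the factor det g in [f]. *)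
pose H (p : V) := p.1 *m diag_mx p.2 *m \adj p.1.
pose f i (p : V) := \det (L (H p) - (\det p.1 * p.2 0 i)%:M).
have h1 i j : poly_on_lines (fun p : V => p.1 i j).
  by move=> p q; apply: poly_on_lines_entry.
have h2 i : poly_on_lines (fun p : V => p.2 0 i).
  by move=> p q; apply: poly_on_lines_entry.
have hdet : poly_on_lines (fun p : V => \det p.1) by apply: poly_on_lines_det.
have hH i j : poly_on_lines (fun p => H p i j).
  apply: poly_on_lines_mul; last exact: poly_on_lines_adj.
  apply: poly_on_lines_mul => // k l.
  have hd := poly_on_linesM (h2 k) (@poly_on_lines_const _ V ((k == l)%:R)).
  by apply: poly_on_lines_ext hd => p; rewrite mxE mulr_natr.
have hf i : poly_on_lines (f i).
  apply: poly_on_lines_det => k l.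
  have hd := poly_on_linesB (poly_on_lines_real_linear hH k l)
    (poly_on_linesM (poly_on_linesM hdet (h2 i)) (@poly_on_lines_const _ V ((k == l)%:R))).
  by apply: poly_on_lines_ext hd => p; rewrite !mxE mulr_natr.
have HE (g : M) d : g \in unitmx -> H (g, d) = g *m diag_mx (\det g *: d) *m invmx g.
  move=> ug; have dg : \det g != 0 by rewrite -unitfE -unitmxE.
  have -> : diag_mx (\det g *: d) = \det g *: diag_mx d.
    by apply/matrixP => i j; rewrite !mxE mulrnAr.
  have -> : invmx g = (\det g)^-1 *: \adj g by rewrite /invmx ug.
  by rewrite -!scalemxAr -scalemxAl scalerA mulVf // scale1r.
(* The eigenvalues of H are read off only for invertible g, so the product is multiplied by det g,
   which is nonzero at g = 1 and can be cancelled. *)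
have [p|h0|h0] := @poly_on_lines_zero_divisor _ _ _ _ hdet
  (@poly_on_lines_prod _ _ _ (index_enum 'I_n) xpredT f hf).
- have [->|dg] := eqVneq (\det p.1) 0; first by rewrite mul0r.
  have ug : p.1 \in unitmx by rewrite unitmxE unitfE.
  apply/eqP; rewrite mulf_eq0; apply/orP; right.
  have [l [lL]] := specL (H p).
  rewrite [in X in X -> _](surjective_pairing p) HE // det_conj_shift // det_diag_shift.
  move=> /eqP /prodf_eq0[i _]; rewrite mxE subr_eq0 => /eqP il.
  by apply/prodf_eq0; exists i => //; rewrite /f il lL.
- by have := h0 (1%:M, 0) => /= /eqP; rewrite det1 oner_eq0.
- have [i0 hi0] := poly_on_lines_prod_eq0 hf h0.
  exists i0 => g d ug; have dg : \det g != 0 by rewrite -unitfE -unitmxE.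
  (* Dividing the diagonal by det g undoes the scaling caused by the adjugate. *)
  have := hi0 (g, (\det g)^-1 *: d).
  by rewrite /f HE // scalerA divff // scale1r /= mxE mulrA divff // mul1r.
Qed.

(** Conjugating by the transposition of i0 and j presents the same matrix with its j-th eigenvalue
    in position i0. *)
Lemma diag_eigenvalues (g : M) (d : 'rV[C]_n) j : g \in unitmx ->
  \det (L (g *m diag_mx d *m invmx g) - (d 0 j)%:M) = 0.
Proof.
move=> ug; have [i0 hi0] := exists_common_index.
pose s := tperm i0 j; pose d' := \row_k d 0 (s k).
have uP : perm_mx s \in @unitmx C n by apply: unitmx_perm.
have ug' : g *m perm_mx s \in unitmx by rewrite unitmx_mul ug.
have := hi0 _ d' ug'; rewrite mxE tpermL.
suff -> : g *m perm_mx s *m diag_mx d' *m invmx (g *m perm_mx s)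
  = g *m diag_mx d *m invmx g by [].
suff E : perm_mx s *m diag_mx d' = diag_mx d *m perm_mx s.
  apply: (can_inj (mulmxK ug')); rewrite (mulmxKV ug').
  by rewrite -mulmxA E !mulmxA (mulmxKV ug).
by apply/matrixP => a b; rewrite mul_mx_diag mul_diag_mx !mxE;
   case: eqP => [<-|]; rewrite ?mulr1 ?mul1r ?mul0r ?mulr0 // tpermK.
Qed.

Lemma char_poly_preserved_diag (g : M) (d : 'rV[C]_n) : g \in unitmx ->
  injective (d 0) ->
  char_poly (L (g *m diag_mx d *m invmx g)) = \prod_i ('X - (d 0 i)%:P).
Proof.
move=> ug dI; set A := L _.
have -> : \prod_i ('X - (d 0 i)%:P) = \prod_(a <- [seq d 0 i | i <- enum 'I_n]) ('X - a%:P).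
  by rewrite big_map big_enum.
rewrite [LHS](@all_roots_prod_XsubC _ _ [seq d 0 i | i <- enum 'I_n]).
- by rewrite (monicP (char_poly_monic A)) scale1r.
- by rewrite size_char_poly size_map size_enum_ord.
- apply/allP => _ /mapP[i _ ->]; rewrite root_char_polyE.
  by rewrite diag_eigenvalues.
- by rewrite uniq_rootsE map_inj_uniq ?enum_uniq.
Qed.

(** Distinct diagonal entries split the characteristic polynomial into simple factors; the minimal
    polynomial divides it, so A is diagonalisable with distinct eigenvalues. *)
Lemma trace_preserved_trig (A T g : M) k : g \in unitmx -> is_trig_mx T ->
  injective (fun i => T i i) -> A = g *m T *m invmx g ->
  \tr (L A ^+ k) = \tr (A ^+ k).
Proof.
move=> ug tT Ti AE.
have cA : char_poly A = \prod_i ('X - (T i i)%:P).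
  by rewrite AE char_poly_conj // char_poly_trig.
have : exists2 rs : seq C, uniq rs & mxminpoly A %| \prod_(x <- rs) ('X - x%:P).
  exists [seq T i i | i <- enum 'I_n]; first by rewrite map_inj_uniq ?enum_uniq.
  by rewrite big_map big_enum -cA mxminpoly_dvd_char.
move=> /(mxred.diagonalizableP A)[P uP /(similar_diagLR uP)[d]].
have uV : invmx P \in unitmx by rewrite unitmx_inv.
rewrite (conjumx _ uV) => AE2.
have cA2 : char_poly A = \prod_i ('X - (d 0 i)%:P).
  by rewrite AE2 char_poly_conj // char_poly_trig ?diag_mx_is_trig //;
     apply: eq_bigr => i _; rewrite mxE eqxx.
have dI : injective (d 0).
  have : perm_eq [seq T i i | i <- enum 'I_n] [seq d 0 i | i <- enum 'I_n].
    by apply: prod_XsubC_eq; rewrite [LHS]big_map [LHS]big_enum [RHS]big_map [RHS]big_enum -cA.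
  move=> /perm_uniq; rewrite map_inj_uniq // enum_uniq => /esym ud.
  exact/injectiveP.
by rewrite (mxtrace_exp _ cA2) AE2 (mxtrace_exp _ (char_poly_preserved_diag uV dI)).
Qed.

Lemma poly_on_lines_trace (V : lmodType C) (A : V -> M) k :
  (forall i j, poly_on_lines (fun x => A x i j)) ->
  poly_on_lines (fun x => \tr (A x ^+ k)).
Proof.
move=> hA; apply: poly_on_lines_sum => i.
have h : forall i j, poly_on_lines (fun x => (A x ^+ k) i j).
  elim: k => [|k IH] a b; first exact: poly_on_lines_const.
  have := poly_on_lines_mul hA IH a b.
  by apply: poly_on_lines_ext => x; rewrite exprS.
exact: h.
Qed.

Lemma trace_preserved (A : M) k : \tr (L A ^+ k) = \tr (A ^+ k).
Proof.
have [P /unitarymx_unit uP] := Schur A isT.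
rewrite /similar_to (conjumx _ uP) => tT'.
have [T TE tT] : exists2 T, T = P *m A *m invmx P & is_trig_mx T by exists (P *m A *m invmx P).
(* The diagonal entries 0, ..., n - 1 of [D] are distinct, so those of T + t D are distinct for all
   but finitely many real t. *)
pose D : M := diag_mx (\row_i (i%:R : C)).
pose B := invmx P *m D *m P.
have hL : poly_on_lines (fun X : M => \tr (L X ^+ k) - \tr (X ^+ k)).
  apply: poly_on_linesB; apply: poly_on_lines_trace; last first.
    by move=> i j; apply: poly_on_lines_entry.
  by apply: poly_on_lines_real_linear => i j; apply: poly_on_lines_entry.
have [p hp] := hL A B.
suff p0 : p = 0.
  by apply/eqP; have := hp 0; rewrite p0 horner0 scale0r addr0 -subr_eq0 => ->.
(* For i different from j, [c (i, j)] is the only t at which entries i and j of the diagonal of T +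
   t D have equal real parts. A pair (i, i) merely adds the value 0. *)
pose c (u : 'I_n * 'I_n) : R := (complex.Re (T u.2 u.2) - complex.Re (T u.1 u.1)) / (u.1%:R - u.2%:R).
apply: (@poly_eq0_real _ _ [seq c u | u <- enum {: 'I_n * 'I_n}]) => t tN.
rewrite -hp; apply/eqP; rewrite subr_eq0; apply/eqP.
have uV : invmx P \in unitmx by rewrite unitmx_inv.
apply: (@trace_preserved_trig _ (T + t%:C *: D) (invmx P)) => //.
- apply/is_trig_mxP => i j ij; rewrite !mxE (is_trig_mxP tT) //.
  by rewrite -val_eqE (ltn_eqF ij) mulr0n mulr0 addr0.
- move=> i j /=; rewrite !mxE !eqxx !mulr1n => e.
  apply: contraNeq tN => ij; apply/mapP; exists (i, j); rewrite ?mem_enum // /c /=.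
  have ne : (i%:R - j%:R : R) != 0 by rewrite subr_eq0 eqr_nat.
  have eR : complex.Re (T i i) + t * i%:R = complex.Re (T j j) + t * j%:R.
    have rn (m : nat) : (m%:R : C) = (m%:R : R)%:C by rewrite rmorph_nat.
    move: e; rewrite !rn; case: (T i i) (T j j) => [a b] [a' b'] [] /=.
    by rewrite !mul0r !subr0.
  apply: (mulIf ne); rewrite divfK // mulrBr; apply/eqP.
  move/eqP: eR; rewrite -subr_eq0 => /eqP eR; rewrite -subr_eq0 -[X in _ == X]eR.
  by apply/eqP; ring.
- by rewrite invmxK mulmxDr mulmxDl TE !mulmxA (mulVmx uP) mul1mx (mulmxKV uP) -scalemxAr -scalemxAl.
Qed.

End RealLinear.

Section Trace.
Variables (F : comNzRingType) (n : nat).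

Lemma mxtrace_mul_delta (x : 'M[F]_n) i j : \tr (x *m delta_mx j i) = x i j.
Proof.
rewrite /mxtrace (bigD1 i) //= big1 => [|k kNi].
  rewrite addr0 mxE (bigD1 j) //= big1 => [|k kNj]; first by rewrite mxE !eqxx mulr1 addr0.
  by rewrite mxE (negPf kNj) mulr0.
by rewrite mxE big1 // => l _; rewrite mxE (negPf kNi) andbF mulr0.
Qed.

Lemma mxtrace_nondegenerate (x : 'M[F]_n) : (forall m, \tr (x *m m) = 0) -> x = 0.
Proof. by move=> h; apply/matrixP => i j; rewrite -mxtrace_mul_delta h mxE. Qed.

End Trace.

Section InnerAutomorphism.
Variables (F : fieldType) (n' : nat).
Local Notation n := n'.+1.
Variable f : 'M[F]_n -> 'M[F]_n.

(** The matrix u sends a vector v to the j0-th column of f (v e_0^T). Multiplicativity turns f x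
    applied to this column into the column of x v, so f x intertwines with x through u. *)
Lemma multiplicative_inner : (forall x y, f (x + y) = f x + f y) ->
  (forall c x, f (c *: x) = c *: f x) -> (forall x y, f (x *m y) = f x *m f y) ->
  (forall x, f x = 0 -> x = 0) ->
  exists2 u, u \in unitmx & forall x, f x = u *m x *m invmx u.
Proof.
move=> fD fZ fM fI.
have f0 : f 0 = 0 by have := fZ 0 0; rewrite !scale0r.
have fS (I : Type) (s : seq I) g : f (\sum_(i <- s) g i) = \sum_(i <- s) f (g i).
  by elim: s => [|i s IH]; rewrite ?big_nil // !big_cons fD IH.
have [[i0 j0] e00] : exists p, f (delta_mx 0 0) p.1 p.2 != 0.
  apply: NNPP => h; have /fI/matrixP/(_ 0 0) : f (delta_mx 0 0) = 0.
    apply/matrixP => i j; rewrite [RHS]mxE; apply/eqP/negPn/negP => ne.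
    by apply: h; exists (i, j).
  by rewrite !mxE => /eqP; rewrite oner_eq0.
pose u : 'M[F]_n := \matrix_(i, j) f (delta_mx j 0) i j0.
have uE x : f x *m u = u *m x.
  apply/matrixP => i j; rewrite !mxE.
  transitivity ((f x *m f (delta_mx j 0)) i j0).
    by rewrite mxE; apply: eq_bigr => k _; rewrite mxE.
  rewrite -fM.
  have -> : x *m delta_mx j 0 = \sum_k x k j *: delta_mx k 0 :> 'M[F]_n.
    apply/matrixP => a b; rewrite summxE mxE (bigD1 j) //= big1 => [|k kNj].
      rewrite (bigD1 a) //= big1 => [|k kNa]; rewrite !mxE.
        by rewrite !eqxx !addr0.
      by rewrite eq_sym (negPf kNa) mulr0.
    by rewrite mxE (negPf kNj) mulr0.
  rewrite fS summxE; apply: eq_bigr => k _.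
  by rewrite fZ !mxE mulrC.
have uu : u \in unitmx.
  rewrite -unitmx_tr -row_free_unit; apply: inj_row_free => v /(congr1 trmx).
  rewrite trmx_mul trmxK trmx0 => uv; apply/rowP => i; rewrite [RHS]mxE.
  (* By intertwining, this product is u E_{0i} v^T; its entry in row i0 is v_i times the (i0, j0)
     entry of f E_{00}, which is nonzero. *)
  have : f (delta_mx 0 i) *m (u *m v^T) = 0 by rewrite uv mulmx0.
  rewrite mulmxA uE -mulmxA => /matrixP/(_ i0 0).
  rewrite [LHS]mxE [RHS]mxE (bigD1 0) //= big1 => [|k kN0]; last first.
    by rewrite [X in _ * X]mxE big1 ?mulr0 // => l _; rewrite !mxE (negPf kN0) mul0r.
  rewrite addr0 [X in _ * X]mxE (bigD1 i) //= big1 => [|k kNi]; last first.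
    by rewrite !mxE (negPf kNi) andbF mul0r.
  by rewrite !mxE !eqxx mul1r addr0 => /eqP; rewrite mulf_eq0 (negPf e00) => /eqP.
by exists u => // x; rewrite -uE mulmxK.
Qed.

End InnerAutomorphism.

(** * Jordan maps of the full matrix algebra *)

Section JordanMap.
Variables (R : rcfType) (n' : nat).
Local Notation C := R[i].
Local Notation n := n'.+1.
Local Notation M := 'M[C]_n.
Variable L : M -> M.
Hypothesis LD : forall h k, L (h + k) = L h + L k.
Hypothesis Lsq : forall a, L (a * a) = L a * L a.

Lemma jordan_sym a b : L (a * b + b * a) = L a * L b + L b * L a.
Proof.
have := Lsq (a + b); rewrite LD !mulrDl !mulrDr !LD !Lsq.
move: (L a * L a) (L b * L b) (L a * L b) (L b * L a) (L (a * b)) (L (b * a)) => x y z t u v.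
move=> e; apply: (addrI x); apply: (addIr y); rewrite !addrA -!addrA.
by move: e; rewrite -!addrA.
Qed.

Lemma matrix_mulr2n_inj (x y : M) : x *+ 2 = y *+ 2 -> x = y.
Proof.
move=> e; apply/matrixP => i j; move/matrixP/(_ i j): e; rewrite !mxE => e.
apply: (@mulIf _ (2%:R : C)); first by rewrite pnatr_eq0.
by rewrite !mulr_natr.
Qed.

(** The product a b a is expressible through the Jordan product: (ab + ba)a + a(ab + ba) = a^2 b + b
    a^2 + 2 aba. *)
Lemma jordan_triple a b : L (a * b * a) = L a * L b * L a.
Proof.
have exp (x y : M) : (x * y + y * x) * x + x * (x * y + y * x)
    = (x * x * y + y * (x * x)) + (x * y * x) *+ 2.
  rewrite mulrDl mulrDr !mulrA; move: (x * y * x) (y * x * x) (x * x * y) => u v w.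
  by apply/matrixP => i j; rewrite !mxE; ring.
have L2 x : L (x *+ 2) = L x *+ 2 by rewrite !mulr2n LD.
apply: matrix_mulr2n_inj; rewrite -L2; apply: (addrI (L (a * a * b + b * (a * a)))).
by rewrite -LD -exp jordan_sym !jordan_sym Lsq exp.
Qed.

(** Polarisation of [jordan_triple] in its first argument. *)
Lemma jordan_triple_sym a b c :
  L (a * b * c + c * b * a) = L a * L b * L c + L c * L b * L a.
Proof.
have exp (x y z : M) : (x + z) * y * (x + z)
    = x * y * x + z * y * z + (x * y * z + z * y * x).
  rewrite !mulrDl !mulrDr.
  move: (x * y * x) (z * y * z) (x * y * z) (z * y * x) => u v w t.
  by apply/matrixP => i j; rewrite !mxE; ring.
have := jordan_triple (a + c) b; rewrite LD !exp !LD !jordan_triple.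
by move/addrI.
Qed.

(* Herstein: evaluate L on (ab)r(ba) + (ba)r(ab) = a(brb)a + b(ara)b in both ways. *)
Lemma jordan_herstein a b r :
  (L (a * b) - L a * L b) * L r * (L (a * b) - L b * L a)
  + (L (a * b) - L b * L a) * L r * (L (a * b) - L a * L b) = 0.
Proof.
have e1 := jordan_triple_sym (a * b) r (b * a).
have e2 : a * b * r * (b * a) + b * a * r * (a * b)
   = a * (b * r * b) * a + b * (a * r * a) * b by rewrite !mulrA.
have e3 := jordan_sym a b; rewrite LD in e3.
have {}e3 : L (b * a) = L a * L b + L b * L a - L (a * b) by rewrite -e3 addrC addKr.
rewrite e2 LD !jordan_triple e3 !mulrA -(mulrA (L a * L b * L r)) in e1.
rewrite -(mulrA (L b * L a * L r)) in e1.
move: e1; move: (L a * L b) (L b * L a) (L (a * b)) (L r) => x y p q.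
have exp1 (S : pzRingType) (u v w z : S) :
    (u - v) * w * (u - z) = u * w * u - u * w * z - v * w * u + v * w * z.
  by rewrite !mulrBl !mulrBr opprB addrA addrAC.
have exp2 (S : pzRingType) (u v w z : S) :
    u * w * (v + z - u) = u * w * v + u * w * z - u * w * u by rewrite mulrBr mulrDr.
have exp3 (S : pzRingType) (u v w z : S) :
    (v + z - u) * w * u = v * w * u + z * w * u - u * w * u by rewrite !mulrBl !mulrDl.
rewrite !exp1 exp2 exp3.
move: (x * q * y) (y * q * x) (p * q * x) (p * q * y) (p * q * p) (x * q * p) (y * q * p).
move=> x1 x2 x3 x4 x5 x6 x7 /eqP; rewrite -subr_eq0 => /eqP/matrixP e.
by apply/matrixP => i j; move: (e i j); rewrite !mxE => <-; ring.
Qed.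

(** Taking r to be a matrix unit gives X_ij Y_kl + Y_ij X_kl = 0. At a nonzero entry X_ij, the
    choice (k, l) = (i, j) gives Y_ij = 0, and then every Y_kl is 0. *)
Lemma matrix_sym_prime (X Y : M) : (forall r, X * r * Y + Y * r * X = 0) -> X = 0 \/ Y = 0.
Proof.
move=> h; have h' i j k l : X i j * Y k l + Y i j * X k l = 0.
  have XdY (A B : M) : (A * delta_mx j k * B) i l = A i j * B k l.
    rewrite -!mulmxE !mxE (bigD1 k) //= big1 => [|m mNk]; last first.
      by rewrite mxE big1 ?mul0r // => o _; rewrite mxE (negPf mNk) andbF mulr0.
    rewrite addr0 mxE (bigD1 j) //= big1 => [|m mNj]; last by rewrite mxE (negPf mNj) mulr0.
    by rewrite mxE !eqxx mulr1 addr0.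
  by have /matrixP/(_ i l) := h (delta_mx j k); rewrite mxE !XdY mxE.
have [->|X0] := eqVneq X 0; [by left|right].
have [[i j] /= Xij] : exists p, X p.1 p.2 != 0.
  apply: NNPP => hN; move/eqP: X0; apply; apply/matrixP => i j; rewrite [RHS]mxE.
  by apply/eqP/negPn/negP => ne; apply: hN; exists (i, j).
have Yij : Y i j = 0.
  have /eqP := h' i j i j; rewrite [Y i j * _]mulrC -mulr2n mulrn_eq0 mulf_eq0 (negPf Xij) /=.
  by move/eqP.
apply/matrixP => k l; rewrite [RHS]mxE.
by have /eqP := h' i j k l; rewrite Yij mul0r addr0 mulf_eq0 (negPf Xij) => /eqP.
Qed.

Hypothesis LZ : forall c h, L (c *: h) = c *: L h.
Hypothesis Lsurj : forall m, exists h, L h = m.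

(** Herstein's identity gives an alternative that may depend on (a, b). The entries of both defects
    are polynomial along lines in (a, b), so absence of zero divisors makes the alternative
    uniform. *)
Lemma jordan_hom_or_antihom :
  (forall a b, L (a * b) = L a * L b) \/ (forall a b, L (a * b) = L b * L a).
Proof.
have Llin : real_linear L by split.
have XY a b : L (a * b) - L a * L b = 0 \/ L (a * b) - L b * L a = 0.
  apply: matrix_sym_prime => r; have [s <-] := Lsurj r.
  exact: jordan_herstein.
pose V := (M * M)%type.
have pe1 i j : poly_on_lines (fun p : V => p.1 i j).
  by move=> p q; apply: poly_on_lines_entry.
have pe2 i j : poly_on_lines (fun p : V => p.2 i j).
  by move=> p q; apply: poly_on_lines_entry.
have pL1 := poly_on_lines_real_linear Llin pe1.
have pL2 := poly_on_lines_real_linear Llin pe2.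
have pL := poly_on_lines_real_linear Llin (poly_on_lines_mul pe1 pe2).
pose X i j (p : V) := L (p.1 *m p.2) i j - (L p.1 *m L p.2) i j.
pose Y i j (p : V) := L (p.1 *m p.2) i j - (L p.2 *m L p.1) i j.
have pX i j : poly_on_lines (X i j).
  by apply: poly_on_linesB; [apply: pL|apply: poly_on_lines_mul].
have pY i j : poly_on_lines (Y i j).
  by apply: poly_on_linesB; [apply: pL|apply: poly_on_lines_mul].
have XY0 i j k l p : X i j p * Y k l p = 0.
  have XE : X i j p = (L (p.1 * p.2) - L p.1 * L p.2) i j by rewrite [RHS]mxE [in RHS]mxE.
  have YE : Y k l p = (L (p.1 * p.2) - L p.2 * L p.1) k l by rewrite [RHS]mxE [in RHS]mxE.
  by rewrite XE YE; have [->|->] := XY p.1 p.2; rewrite ?[(0 : M) _ _]mxE ?mul0r ?mulr0.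
have [[i [j [p Xp]]]|hN] := classic (exists i j p, X i j p <> 0); last first.
  left=> a b; apply/matrixP => i j; apply/eqP; rewrite -subr_eq0; apply/eqP.
  by apply: NNPP => ne; apply: hN; exists i, j, (a, b).
right=> a b; apply/matrixP => k l; apply/eqP; rewrite -subr_eq0; apply/eqP.
have [X0|Y0] := poly_on_lines_zero_divisor (pX i j) (pY k l) (XY0 i j k l).
  by case: Xp; apply: X0.
exact: (Y0 (a, b)).
Qed.

End JordanMap.

(** * From trace identities to the standard form *)

Section EigenvaluePreserver.
Variables (R : rcfType) (n' : nat).
Local Notation C := R[i].
Local Notation n := n'.+1.
Local Notation M := 'M[C]_n.
Variable L : M -> M.
Hypothesis linL : real_linear L.
Hypothesis specL : forall h, common_eigenvalue (L h) h.

Let LD := linL.1.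

Lemma preserver_trace2 h k : \tr (L h *m L k) = \tr (h *m k).
Proof.
have exp (x y : M) : \tr ((x + y) ^+ 2) = \tr (x ^+ 2) + \tr (y ^+ 2) + 2%:R * \tr (x *m y).
  rewrite !expr2 mulrDl !mulrDr !mxtraceD -!mulmxE (mxtrace_mulC y x).
  by ring.
have := trace_preserved linL specL (h + k) 2.
rewrite LD !exp !(trace_preserved linL specL) => /addrI.
by apply: mulfI; rewrite pnatr_eq0.
Qed.

(** Subtracting the cubes of x + y and x - y cancels the terms of even degree in y, which leaves tr
    (x x y) and the known tr (y^3). *)
Lemma preserver_trace3 a b : \tr (L a *m L a *m L b) = \tr (a *m a *m b).
Proof.
have exp (x y : M) : \tr ((x + y) ^+ 3) - \tr ((x - y) ^+ 3)
    = 6%:R * \tr (x *m x *m y) + 2%:R * \tr (y ^+ 3).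
  have cyc (u v w : M) : \tr (u *m v *m w) = \tr (v *m w *m u).
    by rewrite -mulmxA mxtrace_mulC.
  rewrite !exprSr !expr0 !mul1r !(mulrDl, mulrDr) !(mulrN, mulNr, opprK).
  rewrite !mxtraceD !raddfN /= -!mulmxE.
  rewrite (cyc y x x) (cyc x y x) (cyc y x x) (cyc x y y) (cyc y y x) (cyc y x y).
  by ring.
have := exp (L a) (L b); rewrite -LD -(real_linearB linL) !(trace_preserved linL specL) exp.
by move/addIr/mulfI => -> //; rewrite pnatr_eq0.
Qed.

(** [A'] is the complex-linear map that agrees with L on matrix units. While L is only real-linear,
    tr (A' h L k) = tr (h k) makes [A'] injective, hence onto; its values are complex combinations
    of values of L, so the range of L is total for the trace form. *)
Let Q : 'M[C]_(n * n) := \matrix_k mxvec (L (vec_mx (delta_mx 0 k))).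
Let A' (h : M) : M := vec_mx (mxvec h *m Q).

Let A'E h : A' h = \sum_k mxvec h 0 k *: L (vec_mx (delta_mx 0 k)).
Proof.
rewrite /A' mulmx_sum_row linear_sum; apply: eq_bigr => k _.
by rewrite linearZ /= rowK mxvecK.
Qed.

Let hE (h : M) : h = \sum_k mxvec h 0 k *: vec_mx (delta_mx 0 k).
Proof.
rewrite -[LHS]mxvecK {1}(row_sum_delta (mxvec h)) linear_sum.
by apply: eq_bigr => k _; rewrite linearZ.
Qed.

Let A'_trace h k : \tr (A' h *m L k) = \tr (h *m k).
Proof.
rewrite A'E [in RHS](hE h) !mulmx_suml !linear_sum /=; apply: eq_bigr => l _.
by rewrite -!scalemxAl [LHS]mxtraceZ [RHS]mxtraceZ preserver_trace2.
Qed.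

Let Q_unit : Q \in unitmx.
Proof.
rewrite -row_free_unit; apply: inj_row_free => v vQ.
apply: (can_inj (@vec_mxK _ _ _)); rewrite linear0; apply: mxtrace_nondegenerate => m.
by rewrite -A'_trace /A' vec_mxK vQ linear0 mul0mx mxtrace0.
Qed.

Lemma preserver_total m : (forall k, \tr (m *m L k) = 0) -> m = 0.
Proof.
move=> h; apply: mxtrace_nondegenerate => k.
have -> : k = A' (vec_mx (mxvec k *m invmx Q)) by rewrite /A' vec_mxK mulmxKV // mxvecK.
by rewrite A'E mulmx_sumr linear_sum big1 // => i _; rewrite -scalemxAr linearZ /= h mulr0.
Qed.

Lemma preserver_scale c h : L (c *: h) = c *: L h.
Proof.
apply/eqP; rewrite -subr_eq0; apply/eqP/preserver_total => k.
rewrite mulmxBl linearB /= -scalemxAl mxtraceZ !preserver_trace2.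
by rewrite -scalemxAl mxtraceZ subrr.
Qed.

Lemma preserver_surj m : exists h, L h = m.
Proof.
exists (vec_mx (mxvec m *m invmx Q)).
rewrite [X in L X]hE real_linear_sum //.
transitivity (A' (vec_mx (mxvec m *m invmx Q))).
  by rewrite A'E; apply: eq_bigr => k _; rewrite preserver_scale.
by rewrite /A' vec_mxK mulmxKV // mxvecK.
Qed.

Lemma preserver_inj h : L h = 0 -> h = 0.
Proof.
by move=> h0; apply: mxtrace_nondegenerate => k; rewrite -preserver_trace2 h0 mul0mx mxtrace0.
Qed.

Lemma preserver_square a : L (a * a) = L a * L a.
Proof.
apply/eqP; rewrite -subr_eq0; apply/eqP/preserver_total => k.
by rewrite mulmxBl linearB /= preserver_trace2 -!mulmxE preserver_trace3 subrr.
Qed.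

Theorem preserver_standard : exists2 u, u \in unitmx &
  (forall x, L x = u *m x *m invmx u) \/ (forall x, L x = u *m x^T *m invmx u).
Proof.
have [h|h] := jordan_hom_or_antihom LD preserver_square preserver_scale preserver_surj.
  have [u uu hu] := multiplicative_inner LD preserver_scale h preserver_inj.
  by exists u => //; left.
have [|||x|u uu hu] := @multiplicative_inner _ _ (fun x => L x^T).
- by move=> x y; rewrite linearD LD.
- by move=> c x; rewrite linearZ preserver_scale.
- by move=> x y; rewrite trmx_mul mulmxE h.
- by move=> /preserver_inj/(congr1 trmx); rewrite trmxK trmx0.
by exists u => //; right=> x; rewrite -[x in LHS]trmxK hu.
Qed.

End EigenvaluePreserver.

(** * Holomorphic isometries *)

Section Norm.
Variable R : rcfType.
Local Notation K := (complex R).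

(** A modulus with values in R rather than in the complex field, free of square roots and still
    submultiplicative. *)
Definition cn (z : K) : R := `|Re z| + `|Im z|.

Lemma cn_ge0 z : 0 <= cn z. Proof. by rewrite /cn addr_ge0. Qed.
Lemma cn0 : cn 0 = 0. Proof. by rewrite /cn /= normr0 addr0. Qed.

Lemma cnD z w : cn (z + w) <= cn z + cn w.
Proof.
case: z w => a b [c d]; rewrite /cn /=.
by have := ler_normD a c; have := ler_normD b d; lra.
Qed.

Lemma cnN z : cn (- z) = cn z.
Proof. by case: z => a b; rewrite /cn /= !normrN. Qed.

Lemma cnM z w : cn (z * w) <= cn z * cn w.
Proof.
case: z w => a b [c d]; rewrite /cn /=.
have := ler_normB (a * c) (b * d); have := ler_normD (a * d) (b * c).
by rewrite !normrM; lra.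
Qed.

Lemma cn_realM (r : R) z : cn (r%:C * z) = `|r| * cn z.
Proof. by case: z => a b; rewrite /cn /= !mul0r subr0 addr0 !normrM mulrDr. Qed.

Lemma cn_eq0 z : cn z <= 0 -> z = 0.
Proof.
case: z => a b; rewrite /cn /= => h.
have a0 : `|a| = 0 by have := normr_ge0 a; have := normr_ge0 b; lra.
have b0 : `|b| = 0 by have := normr_ge0 a; have := normr_ge0 b; lra.
by rewrite (normr0_eq0 a0) (normr0_eq0 b0).
Qed.

Lemma cn_sum (I : Type) (s : seq I) (f : I -> K) :
  cn (\sum_(i <- s) f i) <= \sum_(i <- s) cn (f i).
Proof.
elim: s => [|i s IH]; first by rewrite !big_nil cn0.
by rewrite !big_cons; apply: le_trans (cnD _ _) _; rewrite lerD2l.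
Qed.


Section Matrix.
Variables m n : nat.
Implicit Types X Y : 'M[K]_(m, n).

Definition nrm X : R := \sum_i \sum_j cn (X i j).

Lemma nrm_ge0 X : 0 <= nrm X.
Proof. by apply: sumr_ge0 => i _; apply: sumr_ge0 => j _; apply: cn_ge0. Qed.

Lemma nrm0 : nrm (0 : 'M[K]_(m, n)) = 0.
Proof. by rewrite /nrm big1 // => i _; rewrite big1 // => j _; rewrite mxE cn0. Qed.

Lemma nrmD X Y : nrm (X + Y) <= nrm X + nrm Y.
Proof.
rewrite /nrm -big_split ler_sum // => i _.
by rewrite -big_split ler_sum // => j _; rewrite mxE cnD.
Qed.

Lemma nrmN X : nrm (- X) = nrm X.
Proof. by apply: eq_bigr => i _; apply: eq_bigr => j _; rewrite mxE cnN. Qed.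

Lemma nrmB X Y : nrm (X - Y) <= nrm X + nrm Y.
Proof. by rewrite -(nrmN Y) nrmD. Qed.

Lemma nrmZ c X : nrm (c *: X) <= cn c * nrm X.
Proof.
rewrite /nrm mulr_sumr ler_sum // => i _.
by rewrite mulr_sumr ler_sum // => j _; rewrite mxE cnM.
Qed.

Lemma nrmZr (r : R) X : nrm (r%:C *: X) = `|r| * nrm X.
Proof.
rewrite /nrm mulr_sumr; apply: eq_bigr => i _; rewrite mulr_sumr.
by apply: eq_bigr => j _; rewrite mxE cn_realM.
Qed.

Lemma cn_le_nrm X i j : cn (X i j) <= nrm X.
Proof.
rewrite /nrm (bigD1 i) //= (bigD1 j) //= -addrA lerDl addr_ge0 //.
  by apply: sumr_ge0 => k _; apply: cn_ge0.
by apply: sumr_ge0 => k _; apply: sumr_ge0 => l _; apply: cn_ge0.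
Qed.

Lemma nrm_le X (e : R) : (forall i j, cn (X i j) <= e) -> nrm X <= (m * n)%:R * e.
Proof.
move=> h; apply: (@le_trans _ _ (\sum_(i < m) \sum_(j < n) e)).
  by apply: ler_sum => i _; apply: ler_sum => j _.
by rewrite !sumr_const !card_ord -mulrnA [(n * m)%N]mulnC mulr_natl.
Qed.

Lemma nrm_eq0 X : nrm X <= 0 -> X = 0.
Proof.
by move=> h; apply/matrixP => i j; rewrite mxE; apply: cn_eq0; apply: le_trans (cn_le_nrm _ _ _) h.
Qed.

End Matrix.

Lemma nrmM m n p (X : 'M[K]_(m, n)) (Y : 'M[K]_(n, p)) : nrm (X *m Y) <= nrm X * nrm Y.
Proof.
apply: (@le_trans _ _ (\sum_i \sum_j \sum_k cn (X i k) * cn (Y k j))).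
  apply: ler_sum => i _; apply: ler_sum => j _; rewrite mxE.
  by apply: le_trans (cn_sum _ _) _; apply: ler_sum => k _; apply: cnM.
rewrite {1}/nrm mulr_suml; apply: ler_sum => i _.
rewrite exchange_big /= mulr_suml; apply: ler_sum => k _.
rewrite -mulr_sumr ler_wpM2l ?cn_ge0 // /nrm (bigD1 k) //= lerDl.
by apply: sumr_ge0 => l _; apply: sumr_ge0 => j _; apply: cn_ge0.
Qed.

Lemma cn_trace n (X : 'M[K]_n) : cn (\tr X) <= nrm X.
Proof.
apply: le_trans (cn_sum _ _) _; apply: ler_sum => i _.
rewrite (bigD1 i) //= lerDl; apply: sumr_ge0 => j _; exact: cn_ge0.
Qed.

Lemma nrm_sum m n (I : Type) (s : seq I) (f : I -> 'M[K]_(m, n)) :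
  nrm (\sum_(i <- s) f i) <= \sum_(i <- s) nrm (f i).
Proof.
elim: s => [|i s IH]; first by rewrite !big_nil nrm0.
by rewrite !big_cons; apply: le_trans (nrmD _ _) _; rewrite lerD2l.
Qed.

Lemma cn_Re z : `|Re z| <= cn z. Proof. by rewrite /cn lerDl. Qed.
Lemma cn_Im z : `|Im z| <= cn z. Proof. by rewrite /cn lerDr. Qed.

End Norm.

(** * The two analytic inputs and their proof over the reals *)

Definition real_diff (R : rcfType) (f : R -> R) (s d : R) :=
  forall e : R, 0 < e -> exists2 D : R, 0 < D &
    forall t, `|t| < D -> `|f (s + t) - f s - t * d| <= e * `|t|.

Definition complex_diff (R : rcfType) (f : R[i] -> R[i]) (t d : R[i]) :=
  forall e : R, 0 < e -> exists2 D : R, 0 < D &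
    forall w, cn w < D -> cn (f (t + w) - f t - w * d) <= e * cn w.

Definition complex_cont (R : rcfType) (f : R[i] -> R[i]) (t : R[i]) :=
  forall e : R, 0 < e -> exists2 D : R, 0 < D &
    forall w, cn w < D -> cn (f (t + w) - f t) <= e.

Definition mean_value_property (R : rcfType) := forall (f f' : R -> R) (v E : R),
  (forall s, 0 <= s <= 1 -> real_diff f s (f' s)) ->
  (forall s, 0 <= s <= 1 -> `|f' s - v| <= E) -> `|f 1 - f 0 - v| <= E.

(** The 16 arises in [cauchy_reals]: the Euclidean disc of radius rho / 2 lies in the [cn] ball, the
    circle has radius rho / 4, so each of the real and imaginary parts of g 0 is at most 8 E /
    rho. *)
Definition cauchy_property (R : rcfType) := forall (f g : R[i] -> R[i]) (rho E : R),
  0 < rho -> (forall t, cn t < rho -> complex_diff f t (g t)) ->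
  (forall t, cn t < rho -> complex_cont g t) ->
  (forall t, cn t < rho -> cn (f t) <= E) ->
  rho * cn (g 0) <= 16 * E.

Local Notation R := Rdefinitions.R.

Lemma real_diff_derivable (f : R -> R) (s d : R) : real_diff f s d -> derivable_pt_lim f s d.
Proof.
move=> hf eps /RltP; rewrite R0E => e0.
have [|D D0 hD] := hf (eps / 2); first by lra.
exists (mkposreal _ (elimT RltP D0)) => h hN /= /RltP.
rewrite RabsE => hh; apply/RltP; rewrite RabsE.
have hn : h != 0 by apply/eqP.
have hp : 0 < `|h| by rewrite normr_gt0.
rewrite RminusE RdivE RminusE RplusE.
have -> : (f (s + h) - f s) / h - d = (f (s + h) - f s - h * d) / h.
  by field.
rewrite normrM normfV ltr_pdivrMr //; apply: le_lt_trans (hD _ hh) _.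
by rewrite ltr_pM2r //; lra.
Qed.

Lemma mean_value_reals : mean_value_property R.
Proof.
move=> f f' v E hf hE.
have d01 (x : R) : (Rmin 0 1 <= x <= Rmax 0 1)%coqR -> 0 <= x <= 1.
  rewrite (Rmin_left _ _ Rle_0_1) (Rmax_right _ _ Rle_0_1).

  by case=> /RleP h1 /RleP h2; apply/andP.
have [x hx|x hx|c [/d01 hc]] := MVT_gen f 0%coqR 1%coqR f'.
- apply/is_derive_Reals/real_diff_derivable/hf/d01.
  by case: hx => h1 h2; split; apply: Rlt_le.
- apply: derivable_continuous_pt; exists (f' x).
  exact/real_diff_derivable/hf/d01.
rewrite Rminus_0_r Rmult_1_r RminusE => h.
by have := hE _ hc; rewrite -h.
Qed.

(** The Cauchy-Riemann equations: the differential is multiplication by d. The tolerance is halved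
    because [cn] is at most twice the maximum norm. *)
Lemma complex_diff_parts (f : R[i] -> R[i]) (a b : R) (d : R[i]) :
  complex_diff f (a +i* b) d ->
  differentiable_pt_lim (fun x y => Re (f (x +i* y))) a b (Re d) (- Im d)%coqR /\
  differentiable_pt_lim (fun x y => Im (f (x +i* y))) a b (Im d) (Re d).
Proof.
move=> hf.
suff h (eps : posreal) : exists D : posreal, forall u v : R, 
    (Rabs (u - a) < D)%coqR -> (Rabs (v - b) < D)%coqR ->
    cn (f (u +i* v) - f (a +i* b) - ((u - a) +i* (v - b)) * d)
      <= pos eps * Num.max `|u - a| `|v - b|.
  split=> eps; have [D hD] := h eps; exists D => u v hu hv; apply/RleP;
  rewrite RmultE RmaxE !RabsE; apply: le_trans (hD u v hu hv).
  - apply: le_trans (cn_Re _); rewrite le_eqVlt; apply/orP; left; apply/eqP; congr `|_|.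
    case: (f (u +i* v)) (f (a +i* b)) d {hf h hD} => [p q] [p' q'] [d1 d2] /=.
    by rewrite !RminusE !RplusE !RmultE RoppE; ring.
  - apply: le_trans (cn_Im _); rewrite le_eqVlt; apply/orP; left; apply/eqP; congr `|_|.
    case: (f (u +i* v)) (f (a +i* b)) d {hf h hD} => [p q] [p' q'] [d1 d2] /=.
    by rewrite !RminusE !RplusE !RmultE; ring.
have /RltP := cond_pos eps; rewrite R0E => e0.
have [|D D0 hD] := hf (pos eps / 2); first by lra.
have D2 : 0 < D / 2 by lra.
exists (mkposreal _ (elimT RltP D2)) => u v /= /RltP hu /RltP hv.
rewrite !RabsE !RminusE in hu hv.
have E : u +i* v = a +i* b + ((u - a) +i* (v - b)).
  by congr Complex; rewrite addrC subrK.
have hc : cn ((u - a) +i* (v - b)) = `|u - a| + `|v - b| by [].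
rewrite {1}E; apply: le_trans (hD _ _) _; rewrite hc; first by lra.
have : `|u - a| <= Num.max `|u - a| `|v - b| by rewrite le_max lexx.
have : `|v - b| <= Num.max `|u - a| `|v - b| by rewrite le_max lexx orbT.
set m := Num.max _ _ => h2 h1.
apply: (@le_trans _ _ (pos eps / 2 * (m + m))); last by lra.
by apply: ler_wpM2l; lra.
Qed.

Lemma complex_cont_Re (f : R[i] -> R[i]) (a b : R) :
  complex_cont f (a +i* b) -> continuity_2d_pt (fun x y => Re (f (x +i* y))) a b.
Proof.
move=> hf eps; have /RltP := cond_pos eps; rewrite R0E => e0.
have [|D D0 hD] := hf (pos eps / 2); first by lra.
have D2 : 0 < D / 2 by lra.
exists (mkposreal _ (elimT RltP D2)) => u v /= /RltP hu /RltP hv.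
rewrite !RabsE !RminusE in hu hv *; apply/RltP.
have E : u +i* v = a +i* b + ((u - a) +i* (v - b)).
  by congr Complex; rewrite addrC subrK.
have hc : cn ((u - a) +i* (v - b)) = `|u - a| + `|v - b| by [].
have := hD ((u - a) +i* (v - b)); rewrite hc -E => /(_ ltac:(lra)) h.
apply: le_lt_trans (_ : pos eps / 2 < pos eps); last by lra.
apply: le_trans h; apply: le_trans (cn_Re _).
by case: (f (u +i* v)) (f (a +i* b)) => [p q] [p' q'].
Qed.

Lemma in_disc (rho a b : R) : 0 < rho -> Rlt (Rplus (Rmult a a) (Rmult b b)) (Rmult (rho / 2)%R (rho / 2)%R) ->
  cn (a +i* b) < rho.
Proof.
move=> r0 /RltP; rewrite RplusE !RmultE -!expr2 => h.
have sa := sqr_ge0 a; have sb := sqr_ge0 b.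
have ha : `|a| < rho / 2.
  rewrite -(ltr_pXn2r (n := 2)) ?nnegrE //; last by lra.
  by rewrite real_normK ?num_real //; lra.
have hb : `|b| < rho / 2.
  rewrite -(ltr_pXn2r (n := 2)) ?nnegrE //; last by lra.
  by rewrite real_normK ?num_real //; lra.
by have -> : cn (a +i* b) = `|a| + `|b| by []; lra.
Qed.

Lemma cauchy_reals : cauchy_property R.
Proof.
move=> f g rho E r0 hf hg hE.
have hd := in_disc r0.
have r4 : Rlt 0%R (rho / 4)%R /\ Rlt (rho / 4)%R (rho / 2)%R by split; apply/RltP; lra.
have h1 := @cauchy_estimate (fun a b => Re (f (a +i* b))) (fun a b => Im (f (a +i* b)))
  (fun a b => Re (g (a +i* b))) (fun a b => Im (g (a +i* b))) (rho / 2)%R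
  (fun a b h => proj1 (complex_diff_parts (hf _ (hd _ _ h))))
  (fun a b h => proj2 (complex_diff_parts (hf _ (hd _ _ h))))
  (fun a b h => complex_cont_Re (hg _ (hd _ _ h))) (rho / 4)%R E r4.
(* [cauchy_estimate] bounds only the real part of the derivative; for - i f that real part is the
   imaginary part of g. *)
pose fi t := - 'i%C * f t; pose gi t := - 'i%C * g t.
have fiE t : fi t = Im (f t) +i* - Re (f t).
  by rewrite /fi; case: (f t) => p q; congr Complex => /=; ring.
have giE t : gi t = Im (g t) +i* - Re (g t).
  by rewrite /gi; case: (g t) => p q; congr Complex => /=; ring.
have cni z : cn (- 'i%C * z) = cn z.
  have -> : - 'i%C * z = Im z +i* - Re z by case: z => p q; congr Complex => /=; ring.
  by rewrite /cn /= normrN addrC.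
have hfi t : cn t < rho -> complex_diff fi t (gi t).
  move=> ht e e0; have [D D0 hD] := hf t ht e e0; exists D => // w hw.
  have -> : fi (t + w) - fi t - w * gi t = - 'i%C * (f (t + w) - f t - w * g t).
    by rewrite /fi /gi; ring.
  by rewrite cni; apply: hD.
have hgi t : cn t < rho -> complex_cont gi t.
  move=> ht e e0; have [D D0 hD] := hg t ht e e0; exists D => // w hw.
  by rewrite /gi -mulrBr cni; apply: hD.
have h2 := @cauchy_estimate (fun a b => Re (fi (a +i* b))) (fun a b => Im (fi (a +i* b)))
  (fun a b => Re (gi (a +i* b))) (fun a b => Im (gi (a +i* b))) (rho / 2)%R
  (fun a b h => proj1 (complex_diff_parts (hfi _ (hd _ _ h))))
  (fun a b h => proj2 (complex_diff_parts (hfi _ (hd _ _ h))))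
  (fun a b h => complex_cont_Re (hgi _ (hd _ _ h))) (rho / 4)%R E r4.
have e1 : rho / 4 * `|Re (g 0)| <= 2 * E.
  rewrite -[`|Re (g 0)|]RabsE; apply/RleP; apply: h1 => a b h.
  by split; apply/RleP; rewrite RabsE; apply: le_trans (hE _ (hd _ _ h)); [exact: cn_Re|exact: cn_Im].
have e2 : rho / 4 * `|Im (g 0)| <= 2 * E.
  have -> : Im (g 0) = Re (gi 0) by rewrite giE.
  rewrite -[`|Re (gi 0)|]RabsE; apply/RleP; apply: h2 => a b h.
  split; apply/RleP; rewrite RabsE fiE; apply: le_trans (hE _ (hd _ _ h)); first exact: cn_Im.
  by rewrite -[Im _]/(- Re (f (a +i* b))) normrN; exact: cn_Re.
by rewrite /cn; lra.
Qed.

(** * Rigidity of holomorphic maps with isometric derivatives *)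

Section Rigidity.
Variables (R : rcfType) (n : nat).
Hypothesis mvp : mean_value_property R.
Hypothesis cauchy : cauchy_property R.
Local Notation M := 'M[R[i]]_n.
Local Notation N := ((n * n)%:R : R).

Let N_ge0 : 0 <= N. Proof. exact: ler0n. Qed.

(** The mean value inequality is scalar: it is used on both parts of each of the n^2 entries, hence
    the factor N * 2. *)
Lemma mean_value_path (G G' : R -> M) (V : M) (E : R) :
  (forall s, 0 <= s <= 1 -> forall e, 0 < e -> exists2 D, 0 < D &
     forall t, `|t| < D -> nrm (G (s + t) - G s - t%:C *: G' s) <= e * `|t|) ->
  (forall s, 0 <= s <= 1 -> nrm (G' s - V) <= E) ->
  nrm (G 1 - G 0 - V) <= N * (2 * E).
Proof.
move=> dG bG; apply: nrm_le => i j.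
have hRe : `|Re (G 1 i j) - Re (G 0 i j) - Re (V i j)| <= E.
  apply: (@mvp (fun s => Re (G s i j)) (fun s => Re (G' s i j))) => s hs.
    move=> e e0; have [D D0 hD] := dG s hs e e0; exists D => // t ht.
    apply: le_trans (hD t ht); apply: le_trans (cn_le_nrm _ i j); apply: le_trans (cn_Re _).
    rewrite !mxE; case: (G (s + t) i j) (G s i j) (G' s i j) => [a b] [c d] [p q] /=.
    by rewrite !mul0r subr0.
  apply: le_trans (bG s hs); apply: le_trans (cn_le_nrm _ i j); apply: le_trans (cn_Re _).
  by rewrite !mxE; case: (G' s i j) (V i j) => [a b] [c d].
have hIm : `|Im (G 1 i j) - Im (G 0 i j) - Im (V i j)| <= E.
  apply: (@mvp (fun s => Im (G s i j)) (fun s => Im (G' s i j))) => s hs.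
    move=> e e0; have [D D0 hD] := dG s hs e e0; exists D => // t ht.
    apply: le_trans (hD t ht); apply: le_trans (cn_le_nrm _ i j); apply: le_trans (cn_Im _).
    rewrite !mxE; case: (G (s + t) i j) (G s i j) (G' s i j) => [a b] [c d] [p q] /=.
    by rewrite !mul0r addr0.
  apply: le_trans (bG s hs); apply: le_trans (cn_le_nrm _ i j); apply: le_trans (cn_Im _).
  by rewrite !mxE; case: (G' s i j) (V i j) => [a b] [c d].
move: hRe hIm; rewrite !mxE /cn.
by case: (G 1 i j) (G 0 i j) (V i j) => [a b] [c d] [p q] /=; lra.
Qed.

Definition frechet (H : M -> M) (x : M) (D : M -> M) :=
  forall e : R, 0 < e -> exists2 d, 0 < d &
    forall h, nrm h < d -> nrm (H (x + h) - H x - D h) <= e * nrm h.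

Definition complex_linear (D : M -> M) :=
  (forall h k, D (h + k) = D h + D k) /\ (forall c h, D (c *: h) = c *: D h).

(** Continuity of the derivative is included because the Cauchy estimate differentiates under the
    integral sign. *)
Definition holomorphic (H : M -> M) (D : M -> M -> M) (x0 : M) (r : R) :=
  forall x, nrm (x - x0) < r -> [/\ frechet H x (D x), complex_linear (D x) &
    forall e, 0 < e -> exists2 d, 0 < d &
      forall y, nrm (y - x) < d -> forall h, nrm (D y h - D x h) <= e * nrm h].

Lemma complex_linear0 D : complex_linear D -> D 0 = 0.
Proof. by move=> [_ h]; have := h 0 0; rewrite !scale0r. Qed.

Lemma holomorphic_sub_ball H D x0 r s : s <= r -> holomorphic H D x0 r -> holomorphic H D x0 s.
Proof. by move=> sr hH x hx; apply: hH; apply: lt_le_trans sr. Qed.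

Lemma holomorphic_shift H D x0 r s k : nrm k <= r - s -> holomorphic H D x0 r ->
  holomorphic (fun x => H (x + k)) (fun x => D (x + k)) x0 s.
Proof.
move=> hk hH x hx; have hxk : nrm (x + k - x0) < r.
  by rewrite addrAC; apply: le_lt_trans (nrmD _ _) _; lra.
have [h1 h2 h3] := hH _ hxk; split=> // e e0.
  have [d d0 hd] := h1 e e0; exists d => // h hh.
  by rewrite [x + h + k]addrAC; apply: hd.
have [d d0 hd] := h3 e e0; exists d => // y hy; apply: hd.
by rewrite opprD addrACA subrr addr0.
Qed.

Lemma holomorphicB H D H' D' x0 r : holomorphic H D x0 r -> holomorphic H' D' x0 r ->
  holomorphic (fun x => H x - H' x) (fun x h => D x h - D' x h) x0 r.
Proof.
move=> hH hH' x hx; have [h1 [h2 h2'] h3] := hH _ hx; have [k1 [k2 k2'] k3] := hH' _ hx.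
split.
- move=> e e0; have e2 : 0 < e / 2 by lra.
  have [d d0 hd] := h1 _ e2; have [d' d0' hd'] := k1 _ e2.
  exists (Num.min d d'); first by rewrite lt_min d0.
  move=> h; rewrite lt_min => /andP[a b].
  have -> : H (x + h) - H' (x + h) - (H x - H' x) - (D x h - D' x h)
    = (H (x + h) - H x - D x h) - (H' (x + h) - H' x - D' x h).
    by apply/matrixP => i j; rewrite !mxE; ring.
  by apply: le_trans (nrmB _ _) _; have := hd _ a; have := hd' _ b; lra.
- split=> [h k|c h]; first by rewrite h2 k2 opprD addrACA.
  by rewrite h2' k2' scalerBr.
- move=> e e0; have e2 : 0 < e / 2 by lra.
  have [d d0 hd] := h3 _ e2; have [d' d0' hd'] := k3 _ e2.
  exists (Num.min d d'); first by rewrite lt_min d0.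
  move=> y; rewrite lt_min => /andP[a b] h.
  have -> : D y h - D' y h - (D x h - D' x h) = (D y h - D x h) - (D' y h - D' x h).
    by apply/matrixP => i j; rewrite !mxE; ring.
  by apply: le_trans (nrmB _ _) _; have := hd _ a h; have := hd' _ b h; lra.
Qed.

Lemma ball_convex (x0 x k : M) r s : nrm (x - x0) < r -> nrm (x + k - x0) < r ->
  0 <= s <= 1 -> nrm (x + s%:C *: k - x0) < r.
Proof.
move=> h1 h2 /andP[s0 s1].
have -> : x + s%:C *: k - x0 = (1 - s)%:C *: (x - x0) + s%:C *: (x + k - x0).
  by rewrite rmorphB rmorph1; apply/matrixP => i j; rewrite !mxE; ring.
apply: le_lt_trans (nrmD _ _) _; rewrite !nrmZr (ger0_norm s0) ger0_norm; last by lra.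
have [->|sN0] := eqVneq s 0; first by lra.
have sp : 0 < s by rewrite lt0r sN0.
have : s * nrm (x + k - x0) < s * r by rewrite ltr_pM2l.
have : (1 - s) * nrm (x - x0) <= (1 - s) * r by apply: ler_wpM2l; [lra|exact: ltW].
lra.
Qed.

Lemma holomorphic_mean_value H D x0 r x k V E : holomorphic H D x0 r ->
  nrm (x - x0) < r -> nrm (x + k - x0) < r ->
  (forall s, 0 <= s <= 1 -> nrm (D (x + s%:C *: k) k - V) <= E) ->
  nrm (H (x + k) - H x - V) <= N * (2 * E).
Proof.
move=> hH hx hxk hE.
have := @mean_value_path (fun s => H (x + s%:C *: k)) (fun s => D (x + s%:C *: k) k) V E.
rewrite rmorph1 rmorph0 scale1r scale0r addr0; apply=> // s hs e e0.
have [h1 [_ h2] _] := hH _ (ball_convex hx hxk hs).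
have k1 : 0 < nrm k + 1 by have := nrm_ge0 k; lra.
have [d d0 hd] := h1 (e / (nrm k + 1)) (divr_gt0 e0 k1).
exists (d / (nrm k + 1)); first exact: divr_gt0.
move=> t ht; have := hd (t%:C *: k); rewrite h2 nrmZr rmorphD scalerDl addrA.
have htk : `|t| * nrm k < d.
  apply: le_lt_trans (_ : `|t| * (nrm k + 1) < d); last by rewrite -ltr_pdivlMr.
  by rewrite ler_wpM2l //; lra.
move=> /(_ htk) h; apply: le_trans h _.
have -> : e / (nrm k + 1) * (`|t| * nrm k) = e * `|t| * (nrm k / (nrm k + 1)).
  by field; rewrite gt_eqF.
apply: ler_piMr; first by rewrite mulr_ge0 // ltW.
by rewrite ler_pdivrMr //; lra.
Qed.

Lemma holomorphic_cauchy H D x0 r E x h : 0 < r -> holomorphic H D x0 r ->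
  (forall y, nrm (y - x0) < r -> nrm (H y) <= E) -> nrm (x - x0) < r / 2 ->
  r * nrm (D x h) <= N * (32 * E * nrm h).
Proof.
move=> r0 hH hE hx.
have hxr : nrm (x - x0) < r by lra.
have E0 : 0 <= E by apply: le_trans (hE _ hxr); apply: nrm_ge0.
have [h0|hN0] := eqVneq h 0.
  have [_ /complex_linear0 D0 _] := hH _ hxr.
  by rewrite h0 D0 !nrm0 !mulr0.
have hp : 0 < nrm h.
  by rewrite lt0r nrm_ge0 andbT; apply: contra hN0 => /eqP e; rewrite (@nrm_eq0 _ _ _ h) ?e.
(* For x in the half ball, a complex disc of this radius in direction h stays in the ball of radius
   r. *)
pose rho := r / (2 * nrm h).
have rho0 : 0 < rho by rewrite divr_gt0 // mulr_gt0.
have hb t : cn t < rho -> nrm (x + t *: h - x0) < r.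
  move=> ht; rewrite addrAC; apply: le_lt_trans (nrmD _ _) _.
  have := nrmZ t h; have : cn t * nrm h < rho * nrm h by rewrite ltr_pM2r.
  have -> : rho * nrm h = r / 2 by rewrite /rho; field; rewrite gt_eqF.
  by lra.
suff : nrm (D x h) <= N * (16 * E / rho).
  have -> : 16 * E / rho = 32 * E * nrm h / r.
    by rewrite /rho; field; rewrite !gt_eqF.
  by rewrite mulrA -ler_pdivlMl // mulrC mulrA mulrA.
apply: nrm_le => i j; rewrite ler_pdivlMr // mulrC.
have := @cauchy (fun t => H (x + t *: h) i j) (fun t => D (x + t *: h) h i j) rho E rho0.
rewrite scale0r addr0; apply=> t ht.
- have [h1 [_ h2] _] := hH _ (hb t ht) => e e0.
  have [d d0 hd] := h1 (e / nrm h) (divr_gt0 e0 hp).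
  exists (d / nrm h); first exact: divr_gt0.
  move=> w hw; have hwh : nrm (w *: h) < d.
    by apply: le_lt_trans (nrmZ _ _) _; rewrite -ltr_pdivlMr.
  have := hd _ hwh; rewrite h2 scalerDl addrA => hh.
  have -> : H (x + t *: h + w *: h) i j - H (x + t *: h) i j - w * D (x + t *: h) h i j
    = (H (x + t *: h + w *: h) - H (x + t *: h) - w *: D (x + t *: h) h) i j.
    by rewrite !mxE.
  apply: le_trans (cn_le_nrm _ i j) _; apply: le_trans hh _.
  rewrite -mulrA ler_wpM2l ?(ltW e0) // ler_pdivrMl // mulrC; exact: nrmZ.
- have [_ _ h3] := hH _ (hb t ht) => e e0.
  have [d d0 hd] := h3 (e / nrm h) (divr_gt0 e0 hp).
  exists (d / nrm h); first exact: divr_gt0.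
  move=> w hw; have hwh : nrm (x + (t + w) *: h - (x + t *: h)) < d.
    rewrite opprD addrACA subrr add0r scalerDl addrC addKr.
    by apply: le_lt_trans (nrmZ _ _) _; rewrite -ltr_pdivlMr.
  have := hd _ hwh h; rewrite divfK ?gt_eqF // => hh.
  apply: le_trans hh; apply: le_trans (cn_le_nrm _ i j); by rewrite !mxE.
- by apply: le_trans (cn_le_nrm _ i j) _; apply/hE/hb.
Qed.

(** In [derivative_lipschitz], the mean value bound contributes 2 N and the Cauchy estimate on
    radius r / 2 contributes 64 N / r. *)
Let c0 := 128 * N * N.

(** The increment H (x + k) - H x is itself holomorphic and of size O(nrm k) by the mean value
    inequality; the Cauchy estimate passes this bound to its derivative. *)
Lemma derivative_lipschitz H D x0 r B k x h : 0 < r -> holomorphic H D x0 r ->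
  (forall y h, nrm (y - x0) < r -> nrm (D y h) <= B * nrm h) ->
  nrm k < r / 2 -> nrm (x - x0) < r / 4 ->
  nrm (D (x + k) h - D x h) <= c0 / r * B * nrm k * nrm h.
Proof.
move=> r0 hH hB hk hx.
have h1 : holomorphic (fun x => H (x + k) - H x) (fun x h => D (x + k) h - D x h) x0 (r / 2).
  apply: holomorphicB; first by apply: holomorphic_shift hH; lra.
  by apply: holomorphic_sub_ball hH; lra.
have b1 y : nrm (y - x0) < r / 2 -> nrm (H (y + k) - H y) <= N * (2 * (B * nrm k)).
  move=> hy; rewrite -[X in nrm X]subr0.
  have hy' : nrm (y - x0) < r by lra.
  have hyk : nrm (y + k - x0) < r by rewrite addrAC; apply: le_lt_trans (nrmD _ _) _; lra.
  apply: (holomorphic_mean_value hH) => // s hs; rewrite subr0; apply: hB.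
  exact: ball_convex.
have r2 : 0 < r / 2 by lra.
have := @holomorphic_cauchy _ _ x0 (r / 2) _ x h r2 h1 b1.
have hx2 : nrm (x - x0) < r / 2 / 2 by lra.
move=> /(_ hx2); rewrite -ler_pdivlMl // => hh; apply: le_trans hh _.
rewrite le_eqVlt; apply/orP; left; apply/eqP; rewrite /c0.
by field; rewrite gt_eqF.
Qed.

Lemma mxtrace_polar (a a' b b' : M) : \tr (a' *m b') = \tr (a *m b) ->
  \tr ((a' - a) *m b) + \tr ((b' - b) *m a) = - \tr ((a' - a) *m (b' - b)).
Proof.
have tB (X Y : M) : \tr (X - Y) = \tr X - \tr Y by rewrite linearB.
move=> e; rewrite mulmxBr !mulmxBl !tB e (mxtrace_mulC b') (mxtrace_mulC b).
by ring.
Qed.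

(** The six numbers stand for a trilinear form on the six orders of its arguments. Around the cycle,
    three near sign changes alternate with three near equalities, so a1 returns close to - a1. *)
Lemma cyclic_bound (a1 a2 a3 a4 a5 a6 : R[i]) (S T : R) :
  cn (a1 + a2) <= T -> cn (a2 - a3) <= S -> cn (a3 + a4) <= T ->
  cn (a4 - a5) <= S -> cn (a5 + a6) <= T -> cn (a6 - a1) <= S ->
  cn a1 <= 3 * (S + T).
Proof.
move=> t1 s1 t2 s2 t3 s3.
have cB (z w : R[i]) : cn (z - w) <= cn z + cn w by rewrite -(cnN w) cnD.
have e2 : 2%:C * a1 = (a1 + a2) - (a2 - a3) - (a3 + a4) + (a4 - a5) + (a5 + a6) - (a6 - a1).
  by rewrite rmorphMn rmorph1; ring.
have : cn (2%:C * a1) = 2 * cn a1 by rewrite cn_realM ger0_norm.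
rewrite e2.
move: (a1 + a2) (a2 - a3) (a3 + a4) (a4 - a5) (a5 + a6) (a6 - a1) t1 s1 t2 s2 t3 s3.
move=> z1 z2 z3 z4 z5 z6 t1 s1 t2 s2 t3 s3.
have := cB (z1 - z2 - z3 + z4 + z5) z6; have := cnD (z1 - z2 - z3 + z4) z5.
have := cnD (z1 - z2 - z3) z4; have := cB (z1 - z2) z3; have := cB z1 z2.
have := cn_ge0 a1; lra.
Qed.

Section Isometry.
Variables (F : M -> M) (A : M -> M -> M) (x0 : M) (r B : R).
Hypothesis r0 : 0 < r.
Hypothesis holF : holomorphic F A x0 r.
Hypothesis B0 : 0 <= B.
Hypothesis boundA : forall y h, nrm (y - x0) < r -> nrm (A y h) <= B * nrm h.
Hypothesis isoA : forall y h k, nrm (y - x0) < r -> \tr (A y h *m A y k) = \tr (h *m k).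
Hypothesis surjA : forall y m, nrm (y - x0) < r -> exists h, A y h = m.

(** [c1] and [c2] are the constants for first and second differences of A; the second comes from
    [derivative_lipschitz] applied to an increment of F on the ball of radius r / 4. *)
Let c1 := c0 / r * B.
Let c2 := c0 / (r / 4) * c1.

Local Lemma c0_ge0 : 0 <= c0. Proof. by rewrite /c0 !mulr_ge0. Qed.
Local Lemma c1_ge0 : 0 <= c1.
Proof. by apply: mulr_ge0 B0; apply: divr_ge0 c0_ge0 (ltW r0). Qed.
Local Lemma c2_ge0 : 0 <= c2.
Proof.
have rp := r0.
have r4 : 0 < r / 4 by lra.
by apply: mulr_ge0 c1_ge0; apply: divr_ge0 c0_ge0 (ltW r4).
Qed.

Lemma first_difference x k h : nrm (x - x0) < r / 4 -> nrm k < r / 2 ->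
  nrm (A (x + k) h - A x h) <= c1 * nrm k * nrm h.
Proof. by move=> hx hk; apply: (derivative_lipschitz h r0 holF boundA hk hx). Qed.

Lemma second_difference x k l h : nrm (x - x0) < r / 16 -> nrm k < r / 2 -> nrm l < r / 8 ->
  nrm (A (x + l + k) h - A (x + l) h - (A (x + k) h - A x h)) <= c2 * nrm k * nrm l * nrm h.
Proof.
have rp := r0.
move=> hx hk hl.
have h1 : holomorphic (fun x => F (x + k) - F x) (fun x h => A (x + k) h - A x h) x0 (r / 4).
  apply: holomorphicB; first by apply: holomorphic_shift holF; lra.
  by apply: holomorphic_sub_ball holF; lra.
have r4 : 0 < r / 4 by lra.
have b1 y h' : nrm (y - x0) < r / 4 -> nrm (A (y + k) h' - A y h') <= c1 * nrm k * nrm h'.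
  by move=> hy; apply: first_difference.
have hl' : nrm l < r / 4 / 2 by lra.
have hx' : nrm (x - x0) < r / 4 / 4 by lra.
have hh := @derivative_lipschitz _ _ x0 (r / 4) (c1 * nrm k) l x h r4 h1 b1 hl' hx'.
by apply: le_trans hh _; rewrite /c2 !mulrA.
Qed.

Let symm_half x k h : nrm (x - x0) < r / 16 -> nrm k < r / 32 -> nrm h < r / 32 ->
  nrm (F (x + k + h) - F (x + k) - (F (x + h) - F x) - (A (x + h) k - A x k))
    <= N * (2 * (c2 * nrm h * nrm k * nrm k)).
Proof.
have rp := r0.
move=> hx hk hh.
have h1 : holomorphic (fun x => F (x + h) - F x) (fun x k => A (x + h) k - A x k) x0 (r / 4).
  apply: holomorphicB; first by apply: holomorphic_shift holF; lra.
  by apply: holomorphic_sub_ball holF; lra.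
have hx4 : nrm (x - x0) < r / 4 by lra.
have hxk : nrm (x + k - x0) < r / 4 by rewrite addrAC; apply: le_lt_trans (nrmD _ _) _; lra.
apply: (holomorphic_mean_value h1 hx4 hxk) => s /andP[s0 s1].
have nk := nrm_ge0 k; have nh := nrm_ge0 h.
have hs : nrm (s%:C *: k) <= nrm k.
  rewrite nrmZr ger0_norm // -[X in _ <= X]mul1r; exact: ler_wpM2r.
apply: le_trans (second_difference (k := h) (l := s%:C *: k) k hx _ _) _; [lra|lra|].
by rewrite ler_wpM2r // ler_wpM2l // mulr_ge0 // c2_ge0.
Qed.

(** A finite form of the symmetry of second derivatives: by [symm_half], one second difference of F,
    symmetric in k and h, approximates both increments of A up to third order. *)
Lemma derivative_symmetry x k h e : nrm (x - x0) < r / 16 -> e < r / 32 ->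
  nrm k <= e -> nrm h <= e ->
  nrm (A (x + k) h - A x h - (A (x + h) k - A x k)) <= 4 * N * c2 * e ^+ 3.
Proof.
have rp := r0.
move=> hx he hk hh; have nk := nrm_ge0 k; have nh := nrm_ge0 h.
have hk' : nrm k < r / 32 by lra.
have hh' : nrm h < r / 32 by lra.
have s1 := symm_half hx hk' hh'; have s2 := symm_half hx hh' hk'.
set W := F (x + k + h) - F (x + k) - (F (x + h) - F x) in s1.
have eW : F (x + h + k) - F (x + h) - (F (x + k) - F x) = W.
  by rewrite [x + h + k]addrAC /W; apply/matrixP => i j; rewrite !mxE; ring.
rewrite {}eW in s2.
have -> : A (x + k) h - A x h - (A (x + h) k - A x k)
  = (W - (A (x + h) k - A x k)) - (W - (A (x + k) h - A x h)).
  by apply/matrixP => i j; rewrite !mxE; ring.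
apply: le_trans (nrmB _ _) _.
have p3 a b c : 0 <= a -> 0 <= b -> 0 <= c -> a <= e -> b <= e -> c <= e ->
    N * (2 * (c2 * a * b * c)) <= 2 * N * c2 * e ^+ 3.
  move=> a0 b0 d0 ae be ce.
  have -> : N * (2 * (c2 * a * b * c)) = 2 * N * c2 * (a * b * c) by ring.
  have -> : e ^+ 3 = e * e * e by rewrite !exprS expr0; ring.
  by apply: ler_wpM2l; [rewrite mulr_ge0 ?c2_ge0 // mulr_ge0|rewrite !ler_pM ?mulr_ge0].
have q1 := p3 _ _ _ nh nk nk hh hk hk; have q2 := p3 _ _ _ nk nh nh hk hh hh.
lra.
Qed.

Section Christoffel.
Variables (x : M) (e : R).
Hypothesis hx : nrm (x - x0) < r / 16.
Hypothesis he : e < r / 32.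

Let c k h l := \tr ((A (x + k) h - A x h) *m A x l).

(** The third-order error of [derivative_symmetry] is multiplied by A x l, which is at most B e. *)
Let cS k h l : nrm k <= e -> nrm h <= e -> nrm l <= e ->
  cn (c k h l - c h k l) <= 4 * N * c2 * B * e ^+ 4.
Proof.
have rp := r0; have xp := hx; have ep := he.
move=> hk hh hl; rewrite /c -linearB /= -mulmxBl.
apply: le_trans (cn_trace _) _; apply: le_trans (nrmM _ _) _.
have -> : 4 * N * c2 * B * e ^+ 4 = (4 * N * c2 * e ^+ 3) * (B * e).
  by rewrite exprS; ring.
apply: ler_pM; rewrite ?nrm_ge0 //; first exact: derivative_symmetry.
have hxr : nrm (x - x0) < r by lra.
apply: le_trans (boundA _ hxr) _; exact: ler_wpM2l.
Qed.

(** Comparing the isometry at x and at x + k leaves the trace of a product of two increments of A,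
    each of order e^2. *)
Let cT k h l : nrm k <= e -> nrm h <= e -> nrm l <= e ->
  cn (c k h l + c k l h) <= c1 ^+ 2 * e ^+ 4.
Proof.
have rp := r0; have xp := hx; have ep := he.
move=> hk hh hl; have nk := nrm_ge0 k.
have e0 : 0 <= e by apply: le_trans hk.
have hxr : nrm (x - x0) < r by lra.
have hxk : nrm (x + k - x0) < r by rewrite addrAC; apply: le_lt_trans (nrmD _ _) _; lra.
have -> : c k h l + c k l h
    = - \tr ((A (x + k) h - A x h) *m (A (x + k) l - A x l)).
  have i1 := isoA h l hxk; have i2 := isoA h l hxr.
  by apply: mxtrace_polar; rewrite i1 i2.
rewrite cnN; apply: le_trans (cn_trace _) _; apply: le_trans (nrmM _ _) _.
have b h' : nrm h' <= e -> nrm (A (x + k) h' - A x h') <= c1 * e * e.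
  move=> hh'; apply: le_trans (first_difference _ _ _) _; [lra|lra|].
  apply: ler_pM => //.
  - exact: mulr_ge0 c1_ge0 nk.
  - exact: nrm_ge0.
  - exact: ler_wpM2l c1_ge0 _ _ hk.
have -> : c1 ^+ 2 * e ^+ 4 = (c1 * e * e) * (c1 * e * e) by rewrite !exprS expr0; ring.
by apply: ler_pM; rewrite ?nrm_ge0 ?b.
Qed.

(* c is almost symmetric in its first two arguments and almost antisymmetric in its last two. *)
Lemma christoffel k h l : nrm k <= e -> nrm h <= e -> nrm l <= e ->
  cn (c k h l) <= (12 * N * c2 * B + 3 * c1 ^+ 2) * e ^+ 4.
Proof.
have rp := r0; have xp := hx; have ep := he.
move=> hk hh hl.
have := cyclic_bound (cT hk hh hl) (cS hk hl hh) (cT hl hk hh) (cS hl hh hk)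
  (cT hh hl hk) (cS hh hk hl).
suff -> : (12 * N * c2 * B + 3 * c1 ^+ 2) * e ^+ 4
  = 3 * (4 * N * c2 * B * e ^+ 4 + c1 ^+ 2 * e ^+ 4) by [].
by ring.
Qed.

End Christoffel.

(** Scaling k, h and l by t multiplies the entry increment by t^2, while the trace is O(t^4). The
    increment is therefore O(t^2), negligible against t. *)
Lemma entry_derivative_zero x k h i j : nrm (x - x0) < r / 16 ->
  forall e, 0 < e -> exists2 d, 0 < d & forall t : R, `|t| < d ->
    cn (A (x + t%:C *: k) h i j - A x h i j) <= e * `|t|.
Proof.
have rp := r0.
move=> hx e e0; have hxr : nrm (x - x0) < r by lra.
(* With A x l a matrix unit, the trace reads off the (i, j) entry. *)
have [l hl] := surjA (delta_mx j i) hxr.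
pose mu := nrm k + nrm h + nrm l + 1.
have nk := nrm_ge0 k; have nh := nrm_ge0 h; have nl := nrm_ge0 l.
have mu0 : 0 < mu by rewrite /mu; lra.
pose q := 12 * N * c2 * B + 3 * c1 ^+ 2.
have q0 : 0 <= q.
  apply: addr_ge0; last by rewrite mulr_ge0 // sqr_ge0.
  by rewrite mulr_ge0 // mulr_ge0 ?c2_ge0 // mulr_ge0.
have Q0 : 0 < q * mu ^+ 4 + 1.
  by rewrite ltr_pwDr // mulr_ge0 // exprn_ge0 // ltW.
(* The first bound keeps the scaled vectors within the range of [christoffel]; the second makes q
   mu^4 |t| at most e. *)
exists (Num.min (r / 32 / mu) (e / (q * mu ^+ 4 + 1))).
  by rewrite lt_min !divr_gt0.
move=> t; rewrite lt_min => /andP[t1 t2].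
have [->|tN0] := eqVneq t 0.
  by rewrite scale0r addr0 subrr cn0 normr0 mulr0.
have tp : 0 < `|t| by rewrite normr_gt0.
have he : `|t| * mu < r / 32 by rewrite -ltr_pdivlMr.
have sm h' : nrm h' <= mu -> nrm (t%:C *: h') <= `|t| * mu.
  by move=> hh; rewrite nrmZr ler_wpM2l.
have kt : nrm (t%:C *: k) <= `|t| * mu by apply: sm; rewrite /mu; lra.
have ht : nrm (t%:C *: h) <= `|t| * mu by apply: sm; rewrite /mu; lra.
have lt : nrm (t%:C *: l) <= `|t| * mu by apply: sm; rewrite /mu; lra.
have := christoffel hx he kt ht lt; rewrite -/q.
have hxt : nrm (x + t%:C *: k - x0) < r.
  by rewrite addrAC; apply: le_lt_trans (nrmD _ _) _; lra.
have [_ [_ Z1] _] := holF hxt; have [_ [_ Z2] _] := holF hxr.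
rewrite Z1 !Z2 -scalerBr -scalemxAl -scalemxAr scalerA mxtraceZ hl mxtrace_mul_delta.
have -> : (A (x + t%:C *: k) h - A x h) i j = A (x + t%:C *: k) h i j - A x h i j by rewrite !mxE.
rewrite -rmorphM cn_realM normrM.
move: (cn _) => w hw.
have : w <= q * mu ^+ 4 * (`|t| * `|t|).
  rewrite -(ler_pM2l (mulr_gt0 tp tp)); apply: le_trans hw _.
  by rewrite le_eqVlt; apply/orP; left; apply/eqP; rewrite !exprS expr0; ring.
move=> h1; apply: le_trans h1 _; rewrite mulrA ler_wpM2r //.
apply: ltW; apply: le_lt_trans (_ : (q * mu ^+ 4 + 1) * `|t| < _); last by rewrite mulrC -ltr_pdivlMr.
by rewrite ler_wpM2r //; lra.
Qed.

Lemma derivative_constant x h : nrm (x - x0) < r / 16 -> A x h = A x0 h.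
Proof.
have rp := r0.
move=> hx; pose k := x - x0; apply/matrixP => i j.
have hx0 : nrm (x0 - x0) < r / 16 by rewrite subrr nrm0; lra.
have hxk : nrm (x0 + k - x0) < r / 16 by rewrite addrC addKr.
have hd (s : R) : 0 <= s <= 1 -> forall e, 0 < e -> exists2 d, 0 < d & forall t : R, `|t| < d ->
    cn (A (x0 + (s + t)%:C *: k) h i j - A (x0 + s%:C *: k) h i j) <= e * `|t|.
  move=> hs e e0; have hb := ball_convex hx0 hxk hs.
  have [d d0 hd] := entry_derivative_zero k h i j hb e0.
  exists d; first exact: d0.
  move=> t ht.
  have -> : x0 + (s + t)%:C *: k = x0 + s%:C *: k + t%:C *: k by rewrite rmorphD scalerDl addrA.
  exact: hd.
pose f (g : R[i] -> R) s := g (A (x0 + s%:C *: k) h i j).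
have fE g : (forall z w, g (z - w) = g z - g w) -> (forall z, `|g z| <= cn z) -> f g 1 = f g 0.
  move=> gB gn; apply/eqP; rewrite -subr_eq0 -normr_le0 -[X in `|X|]subr0.
  apply: (@mvp (f g) (fun=> 0)) => s hs; last by rewrite subrr normr0.
  move=> e e0; have [d d0 hd'] := hd s hs e e0; exists d => // t ht.
  by rewrite mulr0 subr0 /f -gB; apply: le_trans (gn _) _; apply: hd'.
have e1 : f (@complex.Re R) 1 = f (@complex.Re R) 0.
  by apply: fE; [case=> a b [c d]|exact: cn_Re].
have e2 : f (@complex.Im R) 1 = f (@complex.Im R) 0.
  by apply: fE; [case=> a b [c d]|exact: cn_Im].
move: e1 e2; rewrite /f rmorph1 rmorph0 scale1r scale0r addr0 /k addrC subrK.
by case: (A x h i j) (A x0 h i j) => [a b] [c d] /= -> ->.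
Qed.

Theorem holomorphic_isometry_affine x : nrm (x - x0) < r / 16 ->
  F x = F x0 + A x0 (x - x0).
Proof.
have rp := r0.
move=> hx; pose k := x - x0.
have hx0 : nrm (x0 - x0) < r / 16 by rewrite subrr nrm0; lra.
have hxk : nrm (x0 + k - x0) < r / 16 by rewrite addrC addKr.
have hF : holomorphic F A x0 (r / 16) by apply: holomorphic_sub_ball holF; lra.
have h0 s : 0 <= s <= 1 -> nrm (A (x0 + s%:C *: k) k - A x0 k) <= 0.
  by move=> hs; rewrite derivative_constant ?subrr ?nrm0 //; apply: ball_convex.
have := holomorphic_mean_value hF hx0 hxk h0; rewrite !mulr0 => /nrm_eq0/eqP.
by rewrite /k [x0 + _]addrC subrK -addrA -opprD subr_eq0 => /eqP.
Qed.

End Isometry.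

End Rigidity.

(** * The derivative of F *)

Section LocalForm.
Variables (R : rcfType) (n' : nat).
Local Notation n := n'.+1.
Local Notation M := 'M[R[i]]_n.

(** A row vector killed by S + E satisfies v = - v E S^-1, which the norm condition forbids unless v
    = 0. *)
Lemma unitmx_perturbation (S E : M) : S \in unitmx ->
  nrm E * nrm (invmx S) < 1 -> S + E \in unitmx.
Proof.
move=> uS hE; rewrite unitmxE unitfE; apply/negP => /det0P[v vN0 hv].
have vE : v = - (v *m E *m invmx S).
  apply: (can_inj (mulmxK uS)); rewrite mulNmx (mulmxKV uS).
  by apply/eqP; rewrite -addr_eq0 -mulmxDr hv.
have v0 : 0 < nrm v.
  by rewrite lt0r nrm_ge0 andbT; apply: contra vN0 => /eqP e; rewrite (@nrm_eq0 _ _ _ v) ?e.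
have : nrm v <= nrm v * (nrm E * nrm (invmx S)).
  rewrite {1}vE nrmN -mulmxA; apply: le_trans (nrmM _ _) _.
  by rewrite ler_wpM2l ?nrm_ge0 // nrmM.
have : nrm v * (nrm E * nrm (invmx S)) < nrm v * 1 by rewrite ltr_pM2l.
lra.
Qed.

Lemma common_eigenvalue_scale (t : R[i]) (A B : M) : t != 0 ->
  common_eigenvalue (t *: A) (t *: B) -> common_eigenvalue A B.
Proof.
move=> tN0 [l [lA lB]]; exists (l / t).
have e (X : M) : \det (t *: X - l%:M) = 0 -> \det (X - (l / t)%:M) = 0.
  have -> : t *: X - l%:M = t *: (X - (l / t)%:M).
    by rewrite scalerBr scale_scalar_mx mulrCA divff // mulr1.
  by rewrite detZ => /eqP; rewrite mulf_eq0 expf_eq0 (negPf tN0) andbF => /eqP.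
by split; apply: e.
Qed.

(** Since h is fixed, only finitely many eigenvalues can be shared. If A has none of them, a single
    radius keeps all these determinants nonzero around A. *)
Lemma common_eigenvalue_limit (A h : M) :
  (forall e : R, 0 < e -> exists2 E, nrm E < e & common_eigenvalue (A + E) h) ->
  common_eigenvalue A h.
Proof.
move=> hE; apply: NNPP => hN.
have [rs rsE] := closed_field_poly_normal (char_poly h).
have memrs l : \det (h - l%:M) = 0 -> l \in rs.
  move=> hl; have : root (char_poly h) l by rewrite root_char_polyE hl.
  by rewrite rsE (monicP (char_poly_monic h)) scale1r root_prod_XsubC.
have [e e0 he] : exists2 e : R, 0 < e & forall l, l \in rs -> \det (h - l%:M) = 0 ->
    forall E, nrm E < e -> \det (A + E - l%:M) != 0.
  elim: rs {rsE memrs} => [|l0 rs [e e0 he]]; first by exists 1.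
  have [d0|dN0] := eqVneq (\det (h - l0%:M)) 0; last first.
    exists e => // l; rewrite inE => /orP[/eqP ->|]; last exact: he.
    by move=> d0; rewrite d0 eqxx in dN0.
  have uS : A - l0%:M \in unitmx.
    rewrite unitmxE unitfE; apply/negP => /eqP dA; apply: hN; by exists l0.
  pose q := nrm (invmx (A - l0%:M)) + 1.
  have q0 : 0 < q by rewrite /q; have := nrm_ge0 (invmx (A - l0%:M)); lra.
  exists (Num.min e q^-1); first by rewrite lt_min e0 invr_gt0.
  move=> l; rewrite inE => /orP[/eqP -> _|lr dl] E; rewrite lt_min => /andP[E1 E2].
    rewrite addrAC -unitfE -unitmxE; apply: unitmx_perturbation => //.
    apply: le_lt_trans (_ : nrm E * q < 1); first by rewrite ler_wpM2l ?nrm_ge0 // /q; lra.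
    by rewrite -ltr_pdivlMr // div1r.
  exact: he.
have [E Ee [l [l1 l2]]] := hE e e0.
by have := he l (memrs _ l2) l2 E Ee; rewrite l1 eqxx.
Qed.

Variables (U : M -> Prop) (F : M -> M) (A : M -> M -> M).
Hypothesis openU : forall x, U x -> exists2 e : R, 0 < e & forall y, nrm (y - x) < e -> U y.
Hypothesis linA : forall x, U x -> real_linear (A x).
Hypothesis diffF : forall x, U x -> frechet F x (A x).
Hypothesis contA : forall x, U x -> forall e : R, 0 < e -> exists2 d : R, 0 < d &
  forall y, nrm (y - x) < d -> forall h, nrm (A y h - A x h) <= e * nrm h.
Hypothesis specF : forall x y, U x -> U y -> common_eigenvalue (F x - F y) (x - y).

(** The difference quotient along h shares an eigenvalue with h, by scaling the condition on F, and
    tends to A x h. *)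
Lemma derivative_common_eigenvalue x h : U x -> common_eigenvalue (A x h) h.
Proof.
move=> Ux; apply: common_eigenvalue_limit => e e0.
have k0 : 0 < nrm h + 1 by have := nrm_ge0 h; lra.
have e1 : 0 < e / (nrm h + 1) by rewrite divr_gt0.
have [d d0 hd] := diffF Ux e1; have [e' e'0 hU] := openU Ux.
pose t := Num.min d e' / (nrm h + 1) / 2.
have m0 : 0 < Num.min d e' by rewrite lt_min d0.
have t0 : 0 < t by rewrite divr_gt0 // divr_gt0.
have th : nrm (t%:C *: h) < Num.min d e'.
  rewrite nrmZr gtr0_norm //; apply: le_lt_trans (_ : t * (nrm h + 1) < _).
    by apply: ler_wpM2l; [exact: ltW|rewrite lerDl].
  by rewrite /t mulrAC divfK ?gt_eqF //; lra.
move: th; rewrite lt_min => /andP[th1 th2].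
have tN0 : t%:C != 0 by rewrite eq_complex /= eqxx andbT gt_eqF.
exists ((t%:C)^-1 *: (F (x + t%:C *: h) - F x) - A x h).
  have [_ hZ] := linA Ux.
  have -> : (t%:C)^-1 *: (F (x + t%:C *: h) - F x) - A x h
    = (t^-1)%:C *: (F (x + t%:C *: h) - F x - A x (t%:C *: h)).
    by rewrite hZ [RHS]scalerBr scalerA fmorphV mulVf // scale1r.
  rewrite nrmZr normfV gtr0_norm // ltr_pdivrMl //.
  apply: le_lt_trans (hd _ th1) _; rewrite nrmZr gtr0_norm // mulrCA.
  rewrite ltr_pM2l // mulrAC ltr_pdivrMr // ltr_pM2l //; lra.
have Ut : U (x + t%:C *: h) by apply: hU; rewrite addrC addKr.
have := specF Ut Ux; rewrite [x + _ - x]addrC addKr => hc.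
apply: (common_eigenvalue_scale tN0).
by rewrite addrC subrK scalerA divff // scale1r.
Qed.

Lemma complex_linear_bounded (D : M -> M) : complex_linear D ->
  exists2 B : R, 0 <= B & forall h, nrm (D h) <= B * nrm h.
Proof.
move=> [DD DZ]; have D0 : D 0 = 0 by have := DZ 0 0; rewrite !scale0r.
have DS (I : Type) (s : seq I) f : D (\sum_(i <- s) f i) = \sum_(i <- s) D (f i).
  by elim: s => [|i s IH]; rewrite ?big_nil // !big_cons DD IH.
exists (\sum_i \sum_j nrm (D (delta_mx i j))).
  by apply: sumr_ge0 => i _; apply: sumr_ge0 => j _; apply: nrm_ge0.
move=> h; rewrite {1}(matrix_sum_delta h) DS mulr_suml.
apply: le_trans (nrm_sum _ _) _; apply: ler_sum => i _.
rewrite DS mulr_suml; apply: le_trans (nrm_sum _ _) _; apply: ler_sum => j _.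
rewrite DZ mulrC; apply: le_trans (nrmZ _ _) _.
by rewrite ler_wpM2r ?nrm_ge0 // cn_le_nrm.
Qed.

Hypothesis mvp : mean_value_property R.
Hypothesis cauchy : cauchy_property R.

Lemma locally_affine x0 : U x0 -> exists2 r : R, 0 < r &
  forall x, nrm (x - x0) < r -> U x /\ F x = F x0 + A x0 (x - x0).
Proof.
move=> U0; have [r1 r10 hU] := openU U0.
have spec x h : U x -> common_eigenvalue (A x h) h by apply: derivative_common_eigenvalue.
have clin x : U x -> complex_linear (A x).
  move=> Ux; split; first by have [] := linA Ux.
  by apply: preserver_scale => [|h]; [exact: linA|exact: spec].
have [B B0 hB] := complex_linear_bounded (clin _ U0).
(* Continuity with tolerance 1 makes B + 1 a bound for A y on the whole ball around x0. *)
have [r2 r20 hc] := contA U0 (ltr01 : 0 < 1 :> R).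
pose r := Num.min r1 r2.
have r0 : 0 < r by rewrite lt_min r10.
have inU y : nrm (y - x0) < r -> U y by rewrite lt_min => /andP[/hU].
have B10 : 0 <= B + 1 by lra.
have holF : holomorphic F A x0 r.
  by move=> y /inU Uy; split; [exact: diffF|exact: clin|exact: contA].
have bA y h : nrm (y - x0) < r -> nrm (A y h) <= (B + 1) * nrm h.
  rewrite lt_min => /andP[_ y2]; have -> : A y h = A x0 h + (A y h - A x0 h).
    by rewrite addrC subrK.
  by apply: le_trans (nrmD _ _) _; have := hB h; have := hc y y2 h; lra.
have iso y h k : nrm (y - x0) < r -> \tr (A y h *m A y k) = \tr (h *m k).
  by move=> /inU Uy; apply: preserver_trace2 => [|h']; [exact: linA|exact: spec].
have surj y m : nrm (y - x0) < r -> exists h, A y h = m.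
  by move=> /inU Uy; apply: preserver_surj => [|h']; [exact: linA|exact: spec].
exists (r / 16); first by lra.
move=> x hx; split; first by apply: inU; lra.
exact: (holomorphic_isometry_affine mvp cauchy r0 holF B10 bA iso surj).
Qed.

(** Two real-affine maps that agree near x0 agree everywhere, since any direction can be scaled into
    the ball. This carries the formula F = L across an affine ball in [VM_all]. *)
Lemma affine_rigid x0 y0 (L : M -> M) : U x0 -> U y0 -> real_linear L ->
  forall r, 0 < r -> (forall x, nrm (x - x0) < r -> F x = F y0 + A y0 (x - y0)) ->
  forall s, 0 < s -> (forall x, nrm (x - x0) < s -> F x = L x) ->
  forall x, F y0 + A y0 (x - y0) = L x.
Proof.
move=> Ux Uy Llin r r0 hr s s0 hs x.
have x00 q : 0 < q -> nrm (x0 - x0) < q by rewrite subrr nrm0.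
have [AD AZ] := linA Uy; have [LD LZ] := Llin.
have AB := real_linearB (linA Uy); have LB := real_linearB Llin.
suff h : A y0 (x - x0) = L (x - x0).
  have -> : x - y0 = (x - x0) + (x0 - y0) by rewrite addrA subrK.
  by rewrite AD h addrCA -hr ?x00 // hs ?x00 // LB subrK.
pose k := x - x0; have k0 : 0 < nrm k + 1 by have := nrm_ge0 k; lra.
pose m := Num.min r s; have m0 : 0 < m by rewrite lt_min r0.
pose t := m / (nrm k + 1) / 2.
have t0 : 0 < t by rewrite divr_gt0 // divr_gt0.
have th : nrm (x0 + t%:C *: k - x0) < m.
  rewrite addrC addKr nrmZr gtr0_norm //; apply: le_lt_trans (_ : t * (nrm k + 1) < _).
    by apply: ler_wpM2l; [exact: ltW|rewrite lerDl].
  by rewrite /t mulrAC divfK ?gt_eqF //; lra.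
move: th; rewrite lt_min => /andP[th1 th2].
have e1 := hr _ th1; rewrite (hs _ th2) LD -(hs x0) ?x00 // (hr x0) ?x00 // in e1.
have E : x0 + t%:C *: k - y0 = (x0 - y0) + t%:C *: k by rewrite addrAC.
rewrite E AD addrA LZ AZ in e1.
have tN0 : t%:C != 0 by rewrite eq_complex /= eqxx andbT gt_eqF.
by move/addrI/(scalerI tN0): e1 => ->.
Qed.

End LocalForm.

(** * Transfer to the concrete matrices *)

(** Write J = L K. If K were nonzero, a real functional with value -1 at K would make Z |-> L Z +
    phi(Z) J another eigenvalue preserver, yet one that kills K, against injectivity. *)
Lemma preserver_translation_eq0 (R : rcfType) n' (L : 'M[R[i]]_n'.+1 -> 'M[R[i]]_n'.+1) J :
  real_linear L -> (forall Z (s : R), common_eigenvalue (L Z + s%:C *: J) Z) -> J = 0.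
Proof.
move=> [LD LZ] hJ.
have spec h : common_eigenvalue (L h) h by have := hJ h 0; rewrite scale0r addr0.
have [K LK] := preserver_surj (conj LD LZ) spec J.
apply: NNPP => JN0.
have [[i j] /= Kij] : exists p, K p.1 p.2 != 0.
  apply: NNPP => hN; apply: JN0.
  have K0 : K = 0.
    apply/matrixP => i j; rewrite [RHS]mxE.
    by apply/eqP/negPn/negP => ne; apply: hN; exists (i, j).
  by rewrite -LK K0 (real_linear0 (conj LD LZ)).
pose phi (Z : 'M[R[i]]_n'.+1) : R := - complex.Re (Z i j / K i j).
have phiD Y Z : phi (Y + Z) = phi Y + phi Z.
  rewrite /phi mxE mulrDl; case: (Y i j / _) (Z i j / _) => [a b] [c d] /=; ring.
have phiZ (r : R) Z : phi (r%:C *: Z) = r * phi Z.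
  rewrite /phi mxE -mulrA; case: (Z i j / _) => [a b] /=; ring.
pose L' Z := L Z + (phi Z)%:C *: J.
have L'lin : real_linear L'.
  split=> [Y Z|r Z]; rewrite /L'.
    by rewrite LD phiD rmorphD scalerDl addrACA.
  by rewrite LZ phiZ rmorphM scalerDr scalerA.
have K0 : K = 0.
  apply: (preserver_inj L'lin) => [h|]; first exact: hJ.
  by rewrite /L' LK /phi divff //= rmorphN1 scaleN1r subrr.
by rewrite K0 mxE eqxx in Kij.
Qed.

Local Notation RR := Rdefinitions.R.
Local Notation K := (complex Rdefinitions.R).

Definition toC (z : Defs.C) : K := Complex (fst z) (snd z).
Definition ofC (z : K) : Defs.C := (complex.Re z, complex.Im z).

Lemma toCK z : ofC (toC z) = z. Proof. by case: z. Qed.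
Lemma ofCK z : toC (ofC z) = z. Proof. by case: z. Qed.
Lemma toCD a b : toC (Defs.Cplus a b) = toC a + toC b. Proof. by []. Qed.
Lemma toCN a : toC (Defs.Copp a) = - toC a. Proof. by []. Qed.
Lemma toCM a b : toC (Defs.Cmult a b) = toC a * toC b. Proof. by []. Qed.

Lemma toC_sum n f : toC (Csum n f) = \sum_(i < n) toC (f i).
Proof.
elim: n => [|n IH]; first by rewrite big_ord0.
by rewrite big_ord_recr /= toCD IH.
Qed.

Lemma Rsum_bigop n f : Rsum n f = \sum_(i < n) f i.
Proof.
elim: n => [|n IH]; first by rewrite big_ord0.
by rewrite big_ord_recr /= RplusE IH.
Qed.

Section Transfer.
Variable n' : nat.
Local Notation n := n'.+1.
Local Notation M := 'M[K]_n.

Definition toM (x : Mat) : M := \matrix_(i, j) toC (x i j).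
(* Beyond n the entries are junk: [inord] reads them in row or column 0. *)
Definition ofM (X : M) : Mat := fun i j => ofC (X (inord i) (inord j)).

Lemma ofMK X : toM (ofM X) = X.
Proof. by apply/matrixP => i j; rewrite mxE ofCK !inord_val. Qed.

Lemma toM_add x y : toM (madd x y) = toM x + toM y.
Proof. by apply/matrixP => i j; rewrite !mxE. Qed.

Lemma toM_sub x y : toM (msub x y) = toM x - toM y.
Proof. by apply/matrixP => i j; rewrite !mxE. Qed.

Lemma toM_scal r x : toM (mscal r x) = r%:C *: toM x.
Proof. by apply/matrixP => i j; rewrite !mxE. Qed.

Lemma toM_mul x y : toM (mmul n x y) = toM x *m toM y.
Proof.
apply/matrixP => i j; rewrite !mxE toC_sum.
by apply: eq_bigr => k _; rewrite !mxE.
Qed.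

Lemma toM_tr x : toM (mtr x) = (toM x)^T.
Proof. by apply/matrixP => i j; rewrite !mxE. Qed.

Lemma toM_id : toM mid = 1%:M.
Proof.
apply/matrixP => i j; rewrite !mxE /mid.
have -> : Nat.eqb i j = (i == j).
  by apply/idP/eqP => [/Nat.eqb_eq/val_inj //|->]; rewrite Nat.eqb_refl.
by case: (i == j).
Qed.

Lemma meqP x y : meq n x y <-> toM x = toM y.
Proof.
split=> [h|h i j /ssrnat.ltP hi /ssrnat.ltP hj].
  by apply/matrixP => i j; rewrite !mxE h //; apply/ssrnat.ltP.
have /matrixP/(_ (Ordinal hi) (Ordinal hj)) := h; rewrite !mxE.
by move=> /(congr1 ofC); rewrite !toCK.
Qed.

Lemma ofM0 : ofM 0 = mzero.
Proof.
apply: functional_extensionality => i; apply: functional_extensionality => j.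
by rewrite /ofM mxE.
Qed.

Lemma ofM_add X Y : ofM (X + Y) = madd (ofM X) (ofM Y).
Proof.
apply: functional_extensionality => i; apply: functional_extensionality => j.
by rewrite /ofM /madd mxE; case: (X _ _) (Y _ _) => [a b] [c d].
Qed.

Lemma ofM_scal (r : RR) X : ofM (r%:C *: X) = mscal r (ofM X).
Proof.
apply: functional_extensionality => i; apply: functional_extensionality => j.
by rewrite /ofM /mscal mxE; case: (X _ _) => [a b].
Qed.

Let sq (x : Mat) (i j : nat) : RR :=
  Rplus (Rmult (fst (x i j)) (fst (x i j))) (Rmult (snd (x i j)) (snd (x i j))).

Lemma mnormE x : mnorm n x = Num.sqrt (\sum_(i < n) \sum_(j < n) sq x i j).
Proof.
rewrite /mnorm RsqrtE Rsum_bigop; congr Num.sqrt.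
by apply: eq_bigr => i _; rewrite Rsum_bigop.
Qed.

Lemma mnorm_le_nrm x : mnorm n x <= nrm (toM x).
Proof.
rewrite mnormE -(ger0_norm (nrm_ge0 (toM x))) -sqrtr_sqr ler_wsqrtr // expr2.
rewrite [X in _ <= X * _]/nrm mulr_suml; apply: ler_sum => i _.
rewrite mulr_suml; apply: ler_sum => j _.
apply: (@le_trans _ _ (cn (toM x i j) * cn (toM x i j))); last first.
  by rewrite ler_wpM2l ?cn_ge0 // cn_le_nrm.
rewrite mxE /cn /sq /toC; case: (x i j) => a b.
rewrite -[complex.Re _]/a -[complex.Im _]/b -[fst _]/a -[snd _]/b RplusE !RmultE.
have e (c : RR) : c * c = `|c| * `|c| by rewrite -normrM ger0_norm // -expr2 sqr_ge0.
rewrite (e a) (e b) mulrDl !mulrDr.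
have := mulr_ge0 (normr_ge0 a) (normr_ge0 b); lra.
Qed.

Lemma mnorm_ge0 x : 0 <= mnorm n x.
Proof. by rewrite mnormE sqrtr_ge0. Qed.

Lemma nrm_le_mnorm x : nrm (toM x) <= (n * n)%:R * (2 * mnorm n x).
Proof.
apply: nrm_le => i j.
have sq0 k l : 0 <= sq x k l.
  by rewrite /sq RplusE !RmultE -!expr2 addr_ge0 ?sqr_ge0.
have hs (c : RR) : c ^+ 2 <= sq x i j -> `|c| <= mnorm n x.
  move=> hc; rewrite mnormE -sqrtr_sqr ler_wsqrtr //; apply: le_trans hc _.
  rewrite (bigD1 i) //= (bigD1 j) //= -addrA lerDl addr_ge0 //.
    by apply: sumr_ge0 => k _.
  by apply: sumr_ge0 => k _; apply: sumr_ge0.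
have h1 : `|(x i j).1| <= mnorm n x.
  by apply: hs; rewrite /sq RplusE !RmultE -!expr2 lerDl sqr_ge0.
have h2 : `|(x i j).2| <= mnorm n x.
  by apply: hs; rewrite /sq RplusE !RmultE -!expr2 lerDr sqr_ge0.
have -> : cn (toM x i j) = `|(x i j).1| + `|(x i j).2| by rewrite mxE.
lra.
Qed.

Lemma in_spec_det x lam : in_spec n x lam -> \det (toM x - (toC lam)%:M) = 0.
Proof.
move=> [v [[i0 [/ssrnat.ltP hi0 vi0]] hv]].
pose w : 'cV[K]_n := \col_i toC (v i).
have wE : (toM x - (toC lam)%:M) *m w = 0.
  apply/matrixP => i j; rewrite mulmxBl mul_scalar_mx !mxE.
  apply/eqP; rewrite subr_eq0 -toCM -(hv i); last by apply/ssrnat.ltP.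
  by rewrite toC_sum; apply/eqP/eq_bigr => k _; rewrite !mxE.
apply/eqP/negPn/negP => dN0.
have u : toM x - (toC lam)%:M \in unitmx by rewrite unitmxE unitfE.
have w0 : w = 0 by rewrite -[w](mulKmx u) wE mulmx0.
apply: vi0; have /matrixP/(_ (Ordinal hi0) 0) := w0; rewrite !mxE => /(congr1 ofC).
by rewrite toCK.
Qed.

Section Theorem5.
Variables (U : Mat -> Prop) (F : Mat -> Mat) (DF : Mat -> Mat -> Mat).
Hypothesis openU : is_open n U.
Hypothesis connU : Defs.is_connected n U.
Hypothesis U0 : U mzero.
Hypothesis linDF : forall x, U x -> is_Rlinear n (DF x).
Hypothesis diffF : forall x, U x -> forall eps : RR, Rlt 0 eps -> exists delta : RR, Rlt 0 delta /\
  forall h, Rlt (mnorm n h) delta -> U (madd x h) ->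
  Rle (mnorm n (msub (msub (F (madd x h)) (F x)) (DF x h))) (Rmult eps (mnorm n h)).
Hypothesis contDF : forall x, U x -> forall eps : RR, Rlt 0 eps -> exists delta : RR, Rlt 0 delta /\
  forall y, U y -> Rlt (mnorm n (msub y x)) delta ->
  forall h, Rle (mnorm n (msub (DF y h) (DF x h))) (Rmult eps (mnorm n h)).
Hypothesis F0 : meq n (F mzero) mzero.
Hypothesis specF : forall x y, U x -> U y ->
  exists lam, in_spec n (msub (F x) (F y)) lam /\ in_spec n (msub x y) lam.

Let UM (X : M) := U (ofM X).
Let FM (X : M) : M := toM (F (ofM X)).
Let AM (X H : M) : M := toM (DF (ofM X) (ofM H)).

Lemma mnorm_toM0 x : toM x = 0 -> mnorm n x = 0.
Proof. by move=> e; apply/le_anti; rewrite mnorm_ge0 andbT; have := mnorm_le_nrm x; rewrite e nrm0. Qed.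

Lemma toM_nrm_eq0 x y : mnorm n (msub x y) <= 0 -> toM x = toM y.
Proof.
move=> h; apply/eqP; rewrite -subr_eq0 -toM_sub; apply/eqP/nrm_eq0.
apply: le_trans (nrm_le_mnorm _) _.
have -> : mnorm n (msub x y) = 0 by apply/le_anti; rewrite h mnorm_ge0.
by rewrite !mulr0 lexx.
Qed.

(** Representatives of the same matrix are at [mnorm] distance zero, so an open set contains both or
    neither. *)
Lemma U_ext x y : U x -> toM y = toM x -> U y.
Proof.
move=> Ux e; have [eps [e0 he]] := openU Ux; apply: he.
by rewrite mnorm_toM0 // toM_sub e subrr.
Qed.

Lemma specM x y : U x -> U y -> common_eigenvalue (toM (F x) - toM (F y)) (toM x - toM y).
Proof.
move=> Ux Uy; have [lam [/in_spec_det h1 /in_spec_det h2]] := specF Ux Uy.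
by exists (toC lam); rewrite -!toM_sub.
Qed.

Let openUM X : UM X -> exists2 e : RR, 0 < e & forall Y, nrm (Y - X) < e -> UM Y.
Proof.
move=> /openU[e [/RltP]]; rewrite R0E => e0 he; exists e => // Y hY; apply: he; apply/RltP.
by apply: le_lt_trans (mnorm_le_nrm _) _; rewrite toM_sub !ofMK.
Qed.

Let linAM X : UM X -> real_linear (AM X).
Proof.
move=> /linDF[hD hZ]; split=> [H H'|r H]; rewrite /AM.
  by rewrite ofM_add -toM_add; apply/meqP.
by rewrite ofM_scal -toM_scal; apply/meqP.
Qed.

Let c : RR := ((n * n)%:R * 2)%R.
Local Lemma c_ge0 : 0 <= c. Proof. apply: mulr_ge0; exact: ler0n. Qed.

(** Tolerances pass from [mnorm] to [nrm] at the cost of the factor c; dividing by c + 1 keeps the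
    denominator visibly positive. *)
Let bound (e : RR) (x : Mat) (H : M) : 0 < e ->
  mnorm n x <= e / (c + 1) * mnorm n (ofM H) -> nrm (toM x) <= e * nrm H.
Proof.
move=> e0 h; have cp := c_ge0; have hH := mnorm_le_nrm (ofM H); rewrite ofMK in hH.
have c1 : 0 < c + 1 by lra.
apply: le_trans (nrm_le_mnorm x) _; rewrite mulrA -/c.
apply: le_trans (_ : c * (e / (c + 1) * nrm H) <= _).
  apply: ler_wpM2l => //; apply: le_trans h _; apply: ler_wpM2l => //.
  by rewrite ltW // divr_gt0.
have -> : c * (e / (c + 1) * nrm H) = e * nrm H * (c / (c + 1)) by field; rewrite gt_eqF.
apply: ler_piMr; first by rewrite mulr_ge0 ?nrm_ge0 // ltW.
by rewrite ler_pdivrMr //; lra.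
Qed.

Let diffFM X : UM X -> frechet FM X (AM X).
Proof.
move=> UX e e0; have cp := c_ge0; have c1 : 0 < c + 1 by lra.
have [d [/RltP]] := diffF UX (elimT RltP (divr_gt0 e0 c1 : 0%coqR < _)).
rewrite R0E => d0 hd; have [d' d'0 hd'] := openUM UX.
exists (Num.min d d'); first by rewrite lt_min d0.
move=> H; rewrite lt_min => /andP[H1 H2].
have UH : U (madd (ofM X) (ofM H)).
  by rewrite -ofM_add; apply: hd'; rewrite addrC addKr.
have /RltP hH : mnorm n (ofM H) < d.
  by apply: le_lt_trans (mnorm_le_nrm _) _; rewrite ofMK.
have /RleP := hd _ hH UH; rewrite RmultE => h.
by have := bound e0 h; rewrite !toM_sub -ofM_add.
Qed.

Let contAM X : UM X -> forall e : RR, 0 < e -> exists2 d : RR, 0 < d &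
  forall Y, nrm (Y - X) < d -> forall H, nrm (AM Y H - AM X H) <= e * nrm H.
Proof.
move=> UX e e0; have cp := c_ge0; have c1 : 0 < c + 1 by lra.
have [d [/RltP]] := contDF UX (elimT RltP (divr_gt0 e0 c1 : 0%coqR < _)).
rewrite R0E => d0 hd; have [d' d'0 hd'] := openUM UX.
exists (Num.min d d'); first by rewrite lt_min d0.
move=> Y; rewrite lt_min => /andP[H1 /hd' UY] H.
have /RltP hY : mnorm n (msub (ofM Y) (ofM X)) < d.
  by apply: le_lt_trans (mnorm_le_nrm _) _; rewrite toM_sub !ofMK.
have /RleP := hd _ UY hY (ofM H); rewrite RmultE => h.
by have := bound e0 h; rewrite toM_sub.
Qed.

Let specFM X Y : UM X -> UM Y -> common_eigenvalue (FM X - FM Y) (X - Y).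
Proof. by move=> UX UY; have := specM UX UY; rewrite !ofMK. Qed.

Let UM0 : UM 0.
Proof. by rewrite /UM ofM0. Qed.

Let affine X (UX : UM X) :=
  locally_affine openUM linAM diffFM contAM specFM mean_value_reals cauchy_reals UX.
Let L := AM 0.

Let FM0 : FM 0 = 0.
Proof.
rewrite /FM ofM0; have /meqP -> := F0; rewrite -ofM0; exact: ofMK.
Qed.

Let VM X := exists2 e : RR, 0 < e & forall Y, nrm (Y - X) < e -> FM Y = L Y.

Let ball_open (Q : M -> Prop) :
  is_open n (fun x => exists2 e : RR, 0 < e & forall Y, nrm (Y - toM x) < e -> Q Y).
Proof.
move=> x [e e0 he]; have cp := c_ge0; have c1 : 0 < c + 1 by lra.
exists (e / 2 / (c + 1)); split; first by apply/RltP; rewrite R0E divr_gt0 //; lra.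
move=> y /RltP hy; exists (e / 2); first by lra.
move=> Y hY; apply: he; rewrite -(subrKA (toM y)).
apply: le_lt_trans (nrmD _ _) _.
suff : nrm (toM y - toM x) <= e / 2 by lra.
rewrite -toM_sub; apply: le_trans (nrm_le_mnorm _) _; rewrite mulrA -/c.
have h0 := mnorm_ge0 (msub y x).
apply: le_trans (_ : (c + 1) * mnorm n (msub y x) <= _); first by apply: ler_wpM2r => //; lra.
by rewrite mulrC -ler_pdivlMr // ltW.
Qed.

(** U is covered by two open sets: the points near which F = L, and the interior of the complement
    of these points. They are disjoint and the first contains 0. *)
Let VM_all X : UM X -> VM X.
Proof.
move=> UX; apply: NNPP => nVX.
have cover x : U x -> VM (toM x) \/
    exists2 e : RR, 0 < e & forall Y, nrm (Y - toM x) < e -> ~ VM Y.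
  move=> Ux; have Ux' : UM (toM x) by apply: U_ext Ux _; rewrite ofMK.
  have [r r0 hr] := affine Ux'.
  (* If the affine ball around x meets [VM], then [affine_rigid] forces F = L on the whole ball;
     otherwise the ball lies in the complement. *)
  have [[Y [hY [e e0 he]]]|hN] := classic (exists Y, nrm (Y - toM x) < r /\ VM Y); last first.
    by right; exists r => // Y hY VY; apply: hN; exists Y.
  left; exists r => // Z hZ; have [_ ->] := hr Z hZ.
  have UY : UM Y by have [] := hr Y hY.
  pose q := r - nrm (Y - toM x).
  have q0 : 0 < q by rewrite /q; lra.
  apply: (affine_rigid linAM UY Ux' (linAM UM0) q0 _ e0 he) => Z' hZ'.
  have hZx : nrm (Z' - toM x) < r.
    rewrite -(subrKA Y); apply: le_lt_trans (nrmD _ _) _; rewrite /q in hZ'; lra.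
  by have [_ ->] := hr Z' hZx.
have V0 : VM (toM mzero).
  have [r r0 hr] := affine UM0; exists r => // Y; rewrite -ofM0 ofMK => /hr[_ ->].
  by rewrite FM0 add0r subr0.
have [x [Ux [Vx [e e0 he]]]] := connU (ball_open (Q := fun Y => FM Y = L Y))
  (ball_open (Q := fun Y => ~ VM Y)) cover (ex_intro _ _ (conj U0 V0))
  (ex_intro _ _ (conj UX (match cover _ UX with or_introl h => False_ind _ (nVX (eq_ind _ VM h _ (ofMK X))) | or_intror h => h end))).
by apply: (he (toM x)) Vx; rewrite subrr nrm0.
Qed.

Let FML X : UM X -> FM X = L X.
Proof. by move=> /VM_all[e e0 he]; apply: he; rewrite subrr nrm0. Qed.

Let specL h : common_eigenvalue (L h) h.
Proof. exact: (derivative_common_eigenvalue openUM linAM diffFM specFM h UM0). Qed.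

(* Only the entries below n matter: a change j of the other entries moves F by a fixed
   matrix J, linearly in j, and then the eigenvalue condition forces J = 0. *)
Lemma F_eq_L x : U x -> toM (F x) = L (toM x).
Proof.
move=> Ux; pose y0 := ofM (toM x); pose j := msub x y0.
have Uy0 : U y0 by apply: U_ext Ux _; rewrite ofMK.
have j0 : toM j = 0 by rewrite toM_sub ofMK subrr.
have Ushift y s : U y -> U (madd y (mscal s j)).
  by move=> Uy; apply: U_ext Uy _; rewrite toM_add toM_scal j0 scaler0 addr0.
(* A multiple of j has [mnorm] zero, so the differentiability estimate becomes an exact equality. *)
have Fshift y (s : RR) : U y -> toM (F (madd y (mscal s j))) = toM (F y) + s%:C *: toM (DF y j).
  move=> Uy; have [d [d0 hd]] := diffF Uy Rlt_0_1.
  have hj : mnorm n (mscal s j) = 0 by rewrite mnorm_toM0 // toM_scal j0 scaler0.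
  have := hd (mscal s j); rewrite hj => h.
  have [_ hZ] := linDF Uy; have /meqP := hZ s j; rewrite toM_scal => <-.
  apply/eqP; rewrite addrC -subr_eq -toM_sub; apply/eqP/toM_nrm_eq0.
  by have /RleP := h d0 (Ushift y s Uy); rewrite RmultE mulr0.
have [d [/RltP]] := contDF Uy0 Rlt_0_1; rewrite R0E => d0 hd.
have [d' d'0 hd'] := openUM Uy0.
have DFj Y : nrm (Y - toM x) < Num.min d d' -> toM (DF (ofM Y) j) = toM (DF y0 j).
  rewrite lt_min => /andP[Y1 Y2]; apply: toM_nrm_eq0.
  have /RltP hY : mnorm n (msub (ofM Y) y0) < d.
    by apply: le_lt_trans (mnorm_le_nrm _) _; rewrite toM_sub !ofMK.
  by have /RleP := hd _ (hd' _ Y2) hY j; rewrite RmultE (mnorm_toM0 j0) mulr0.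
have LD h k : L (h + k) = L h + L k := (linAM UM0).1 h k.
have LZ (r : RR) h : L (r%:C *: h) = r%:C *: L h := (linAM UM0).2 r h.
have J0 : toM (DF y0 j) = 0.
  apply: (preserver_translation_eq0 (linAM UM0)) => Z s.
  have k0 : 0 < nrm Z + 1 by have := nrm_ge0 Z; lra.
  have m0 : 0 < Num.min d d' by rewrite lt_min d0.
  pose t := Num.min d d' / (nrm Z + 1) / 2.
  have t0 : 0 < t by rewrite divr_gt0 // divr_gt0.
  have tN0 : t%:C != 0 by rewrite eq_complex /= eqxx andbT gt_eqF.
  have hY : nrm (toM x + t%:C *: Z - toM x) < Num.min d d'.
    rewrite addrC addKr nrmZr gtr0_norm //; apply: le_lt_trans (_ : t * (nrm Z + 1) < _).
      by apply: ler_wpM2l; [exact: ltW|rewrite lerDl].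
    by rewrite /t mulrAC divfK ?gt_eqF //; lra.
  have UY : U (ofM (toM x + t%:C *: Z)).
    by apply: hd'; move: hY; rewrite lt_min => /andP[].
  apply: (common_eigenvalue_scale tN0).
  (* The shift t s j adds t s J to the value at x + t Z and leaves the underlying matrix unchanged;
     dividing by t gives a common eigenvalue of L Z + s J and Z. *)
  have := specM (Ushift _ (t * s) UY) Uy0.
  rewrite Fshift // (DFj _ hY) toM_add toM_scal j0 scaler0 addr0 !ofMK.
  rewrite -[toM (F (ofM _))]/(FM _) -[toM (F y0)]/(FM _) !FML // LD.
  rewrite [toM x + _ - _]addrC addKr.
  rewrite -[L (toM x) + _ + _ *: _]addrA [L (toM x) + _]addrC addrK.
  have ts : (t * s)%:C = t%:C * s%:C :> K by exact: rmorphM.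
  by rewrite LZ ts -scalerA -scalerDr.
(* Equality of functions is required here, since F is not assumed to respect [meq]. *)
have xE : x = madd y0 (mscal 1 j).
  apply: functional_extensionality => a; apply: functional_extensionality => b.
  rewrite /j /madd /mscal /msub -[LHS]toCK -[RHS]toCK !(toCD, toCM, toCN).
  by congr ofC; rewrite -[toC (1%coqR, _)]/(1 : K) mul1r addrC subrK.
by rewrite xE Fshift // J0 scaler0 addr0 -xE -[toM (F y0)]/(FM _) FML.
Qed.

Lemma standard_form : exists u v : Mat,
  meq n (mmul n u v) mid /\ meq n (mmul n v u) mid /\
  ((forall x, U x -> meq n (F x) (mmul n (mmul n u x) v)) \/
   (forall x, U x -> meq n (F x) (mmul n (mmul n u (mtr x)) v))).
Proof.
have [u uu hu] := preserver_standard (linAM UM0) specL.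
exists (ofM u), (ofM (invmx u)); split; [|split].
- by apply/meqP; rewrite toM_mul !ofMK mulmxV // toM_id.
- by apply/meqP; rewrite toM_mul !ofMK mulVmx // toM_id.
case: hu => hu; [left|right] => x Ux; apply/meqP.
  by rewrite !toM_mul !ofMK F_eq_L // hu.
by rewrite !toM_mul toM_tr !ofMK F_eq_L // hu.
Qed.

End Theorem5.
End Transfer.

Theorem theorem5 (n : nat) (U : Mat -> Prop) (F : Mat -> Mat) :
  (1 <= n)%coq_nat ->
  is_domain n U ->
  U mzero ->
  is_C1_on n U F ->
  meq n (F mzero) mzero ->
  (forall x y, U x -> U y ->
     exists lam, in_spec n (msub (F x) (F y)) lam /\ in_spec n (msub x y) lam) ->
  exists u v : Mat,
    meq n (mmul n u v) mid /\ meq n (mmul n v u) mid /\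
    ((forall x, U x -> meq n (F x) (mmul n (mmul n u x) v)) \/
     (forall x, U x -> meq n (F x) (mmul n (mmul n u (mtr x)) v))).
Proof.
case: n => [/ssrnat.leP //|n] _ [_ [oU cU]] U0 [DF [linDF [diffF contDF]]] F0 specF.
exact: (standard_form oU cU U0 linDF diffF contDF F0 specF).
Qed.
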